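(* Let $A$ be a Borel space. Let $\rho\in\mathcal{C}(A)$ and let $(Y_j,U_j)_{j\geq 1}$ be i.i.d. with law $\rho$. For each $n\ge 1$ define $$\mathbf{W}_n:=\mathtt{ios}(Y_1,\dots,Y_n,U_1,\dots,U_n)\quad\text{and}\quad \eta_n:=\#\{k\in[n]:U_k\leq U_n\}.$$ Then $(\mathbf{W},\boldsymbol{\eta})=(\mathbf{W}_n,\eta_n)_{n\geq 1}$ is an ergodic GEWP over $A$. Moreover, writing $\mathtt{GEWP}(\rho):=\mathcal{L}(\mathbf{W},\boldsymbol{\eta})$ for the law of this process, the map $$\mathcal{C}(A)\rightarrow \mathrm{erg}\,\mathcal{M}(A),\quad \rho\mapsto \mathtt{GEWP}(\rho)$$ is a bijection.
   Context: A measurable space $S$ is a Borel space if there are a Borel subset $E\subseteq[0,1]$ and a bijection $f:S\to E$ with $f,f^{-1}$ measurable. $\mathcal{M}_1(S)$ is the set of probability measures on $S$; $\mathcal{L}(X)$ is the law of $X$; $[n]=\{1,\dots,n\}$. For a word $\mathbf{w}=(w_1,\dots,w_n)\in A^n$ and $i\in[n]$, $\mathtt{erase}(\mathbf{w},i)=(w_1,\dots,w_{i-1},w_{i+1},\dots,w_n)\in A^{n-1}$. A general erased-word process (GEWP) over $A$ is a stochastic process $(\mathbf{W},\boldsymbol{\eta})=(\mathbf{W}_n,\eta_n)_{n\ge1}$ such that for each $n$: (i) $\mathbf{W}_n=(W_{n,1},\dots,W_{n,n})$ is a random word in $A^n$; (ii) $\eta_n$ is uniform on $[n]$ and independent of $\mathcal{F}_n:=\sigma(\mathbf{W}_k,\eta_{k+1}:k\ge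 n)$; (iii) $\mathbf{W}_n=\mathtt{erase}(\mathbf{W}_{n+1},\eta_{n+1})$ almost surely. $\mathcal{M}(A)\subset\mathcal{M}_1(\prod_{n\ge1}A^n\times[n])$ is the (convex) set of all laws of GEWPs over $A$; $\mathrm{erg}\,\mathcal{M}(A)$ is its set of extreme points; a GEWP is called ergodic if its law is in $\mathrm{erg}\,\mathcal{M}(A)$. For real $x_1,\dots,x_n$, $\mathtt{ps}(x_1,\dots,x_n)$ is the permutation $\pi$ of $[n]$ with $x_{\pi(1)}\le\dots\le x_{\pi(n)}$ that sorts stably (ties are broken so that equal values keep the order of their indices). For $y_1,\dots,y_n\in A$, the induced order statistics is $\mathtt{ios}(y_1,\dots,y_n,x_1,\dots,x_n):=(y_{\pi(1)},\dots,y_{\pi(n)})$ with $\pi=\mathtt{ps}(x_1,\dots,x_n)$. $\mathcal{C}(A):=\{\rho\in\mathcal{M}_1(A\times\mathbb{R}):\rho(A\times[0,t])=t\text{ for all }t\in[0,1]\}$, i.e. the laws on $A\times\mathbb{R}$ whose second marginal is $\mathrm{unif}[0,1]$. *)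

(* Defs.v *)
From HB Require Import structures.
From mathcomp Require Import all_boot all_order all_algebra all_fingroup finmap.
From mathcomp Require Import all_classical all_reals all_analysis.
From mathcomp Require Import measurable_realfun giry.

Set Implicit Arguments.
Unset Strict Implicit.
Unset Printing Implicit Defensive.

Import Order.TTheory GRing.Theory Num.Theory.
Import numFieldNormedType.Exports.

Local Open Scope classical_set_scope.
Local Open Scope ring_scope.

(* A measure is a function on all sets, but only its values on measurable sets
   are meaningful; so laws are compared with [measure_eq] (written ≡μ, equality
   on measurable sets) and never with Leibniz equality. *)

(* Indices are shifted by one: the term of index n : nat of a process stands for
   the one of index n+1, a word of length n+1 is an [n.+1.-tuple A] and the index
   set {1, ..., n+1} is ['I_n.+1] = {0, ..., n}. *)

HB.instance Definition _ n := isPointed.Build 'I_n.+1 ord0.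
HB.instance Definition _ n := @isMeasurable.Build default_measure_display
  'I_n.+1 discrete_measurable discrete_measurable0
  discrete_measurableC discrete_measurableU.

Definition borel_space (R : realType) (d : measure_display)
    (S : measurableType d) : Prop :=
  exists (E : set R) (f : S -> R) (g : R -> S),
    [/\ measurable E, E `<=` `[0, 1],
        (forall s, E (f s) /\ g (f s) = s),
        (forall x, E x -> f (g x) = x) &
        measurable_fun setT f /\ measurable_fun E g].

Section words.
Context {T : Type}.

Definition erase n (w : n.+1.-tuple T) (i : 'I_n.+1) : n.-tuple T :=
  [tuple tnth w (lift i j) | j < n].

Definition perm_word n (y : n.-tuple T) (s : 'S_n) : n.-tuple T :=
  [tuple tnth y (s i) | i < n].

End words.

Section sorting_permutation.
Context {R : realType}.

(* Lexicographic order on (x_i, i): sorting for this total order is the stable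
   sorting by the values x_i. *)
Definition stable_le n (x : n.-tuple R) : rel 'I_n := fun i j =>
  (tnth x i < tnth x j) || ((tnth x i == tnth x j) && (i <= j)%N).

Definition ps_fun n (x : n.-tuple R) (i : 'I_n) : 'I_n :=
  tnth (sort_tuple (stable_le x) (ord_tuple n)) i.

Lemma ps_fun_inj n (x : n.-tuple R) : injective (ps_fun x).
Proof.
apply/tuple_uniqP; rewrite /= sort_uniq.
exact: enum_uniq.
Qed.

Definition ps n (x : n.-tuple R) : 'S_n := perm (@ps_fun_inj n x).

Definition ios (T : Type) n (y : n.-tuple T) (x : n.-tuple R) : n.-tuple T :=
  perm_word y (ps x).

(* With values x_1, ..., x_m (m = n.+1), the rank #{k : x_k <= x_m} of the last
   one, which is between 1 and m, minus 1. *)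
Definition last_rank n (x : n.+1.-tuple R) : 'I_n.+1 :=
  inord #|[pred k : 'I_n.+1 | tnth x k <= tnth x ord_max]|.-1.

End sorting_permutation.

Section finite_dependence.
Context {d d' : measure_display} {S : measurableType d} {T : measurableType d'}.

Lemma measurable_preimage_dep (I : finType) (g : S -> I) (X : Type) (h : S -> X)
    (B : set X) :
  (forall i, measurable (g @^-1` [set i])) ->
  (forall w w', g w = g w' -> h w = h w') ->
  measurable (h @^-1` B).
Proof.
move=> mg hg.
have -> : h @^-1` B = \bigcup_(i in g @` (h @^-1` B)) (g @^-1` [set i]).
  apply/seteqP; split => w.
    by move=> hw; exists (g w) => //; exists w.
  by case=> _ [w' hw' <-] /= /hg; rewrite /preimage/= => ->.
apply: fin_bigcup_measurable => [|i _]; last exact: mg.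
exact: finite_finset.
Qed.

Lemma measurable_fun_dep (I : finType) (g : S -> I) (F : I -> S -> T) :
  (forall i, measurable (g @^-1` [set i])) ->
  (forall i, measurable_fun setT (F i)) ->
  measurable_fun setT (fun w => F (g w) w).
Proof.
move=> mg mF _ B mB; rewrite setTI.
have -> : (fun w => F (g w) w) @^-1` B =
    \bigcup_(i in [set: I]) (g @^-1` [set i] `&` F i @^-1` B).
  apply/seteqP; split => w /=.
    by move=> hw; exists (g w).
  by case=> i _ [/= <-].
apply: fin_bigcup_measurable => [|i _]; first exact: finite_finset.
by apply: measurableI => //; rewrite -[X in measurable X]setTI; exact: mF.
Qed.

End finite_dependence.

Section words_measurability.
Context {R : realType} {d d' : measure_display}.
Context {S : measurableType d} {A : measurableType d'}.

Definition comparisons n (x : n.-tuple R) : {ffun 'I_n * 'I_n -> bool} :=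
  [ffun p => tnth x p.1 <= tnth x p.2].

Lemma measurable_comparisons n (x : S -> n.-tuple R) c :
  measurable_fun setT x ->
  measurable ((fun w => comparisons (x w)) @^-1` [set c]).
Proof.
move=> /measurable_fun_tnthP mx.
have -> : (fun w => comparisons (x w)) @^-1` [set c] =
    \bigcap_(p in [set: 'I_n * 'I_n])
      ((fun w => tnth (x w) p.1 <= tnth (x w) p.2) @^-1` [set c p]).
  apply/seteqP; split => w /=.
    by move=> <- p _ /=; rewrite /comparisons ffunE.
  by move=> h; apply/ffunP => p; rewrite ffunE; exact: h.
apply: fin_bigcap_measurable => [|p _]; first exact: finite_finset.
rewrite -[X in measurable X]setTI.
by apply: measurable_fun_ler => //; exact: mx.
Qed.

Lemma comparisons_ps n (x x' : n.-tuple R) :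
  comparisons x = comparisons x' -> ps x = ps x'.
Proof.
move=> /ffunP cE.
have {}cE i j : (tnth x i <= tnth x j) = (tnth x' i <= tnth x' j).
  by have := cE (i, j); rewrite !ffunE.
suff sE : stable_le x = stable_le x'.
  by apply/permP => i; rewrite !permE /ps_fun sE.
by apply/funext => i; apply/funext => j; rewrite /stable_le !ltNge !eq_le !cE.
Qed.

Lemma comparisons_last_rank n (x x' : n.+1.-tuple R) :
  comparisons x = comparisons x' -> last_rank x = last_rank x'.
Proof.
move=> /ffunP cE; congr (inord _.-1); apply: eq_card => i; rewrite !inE.
by have := cE (i, ord_max); rewrite !ffunE.
Qed.

Lemma measurable_ios n (y : S -> n.-tuple A) (x : S -> n.-tuple R) :
  measurable_fun setT y -> measurable_fun setT x ->
  measurable_fun setT (fun w => ios (y w) (x w)).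
Proof.
move=> my mx.
apply: (measurable_fun_dep (g := fun w => ps (x w))
  (F := fun s w => perm_word (y w) s)) => s.
  apply: (measurable_preimage_dep (g := fun w => comparisons (x w))).
    by move=> c; exact: measurable_comparisons.
  by move=> w w'; exact: comparisons_ps.
apply/measurable_fun_tnthP => i.
have -> : (fun t => tnth t i) \o (fun w => perm_word (y w) s) =
    (fun t => tnth t (s i)) \o y.
  by apply/funext => w /=; rewrite tnth_mktuple.
by move/measurable_fun_tnthP : my; apply.
Qed.

Lemma measurable_last_rank n (x : S -> n.+1.-tuple R) :
  measurable_fun setT x -> measurable_fun setT (fun w => last_rank (x w)).
Proof.
move=> mx _ B _; rewrite setTI.
apply: (measurable_preimage_dep (g := fun w => comparisons (x w))).
  by move=> c; exact: measurable_comparisons.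
by move=> w w'; exact: comparisons_last_rank.
Qed.

End words_measurability.

Section independence.
Local Open Scope ereal_scope.
Context {R : realType} {d d' : measure_display}.
Context {Om : measurableType d} {T : measurableType d'} (P : probability Om R).

Definition independent_of (X : {RV P >-> T}) (G : set (set Om)) : Prop :=
  forall (B : set T) (C : set Om), measurable B -> G C ->
    P (X @^-1` B `&` C) = P (X @^-1` B) * P C.

Definition mutually_independent (Z : nat -> {RV P >-> T}) : Prop :=
  forall (J : {fset nat}) (B : nat -> set T), (forall j, measurable (B j)) ->
    P (\bigcap_(j in [set` J]) (Z j @^-1` B j)) =
    \prod_(j <- J) P (Z j @^-1` B j).

Definition iid (Z : nat -> {RV P >-> T}) (rho : probability T R) : Prop :=
  mutually_independent Z /\ forall j, distribution P (Z j) ≡μ rho.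

End independence.

(* Extreme points of a set of probability measures, up to ≡μ. *)
Definition extreme_points (R : realType) (d : measure_display)
    (T : measurableType d) (K : set (probability T R)) : set (probability T R) :=
  [set mu | K mu /\
    forall (t : R) (mu1 mu2 : probability T R), 0 < t < 1 -> K mu1 -> K mu2 ->
      (forall B, measurable B ->
        mu B = t%:E * mu1 B + (1 - t)%:E * mu2 B)%E ->
      mu1 ≡μ mu /\ mu2 ≡μ mu].

Definition cylinders (d : measure_display) (A : measurableType d) :
    set (set (forall n : nat, n.+1.-tuple A * 'I_n.+1)%type) :=
  \bigcup_n preimage_set_system setT
    (fun w : (forall n : nat, n.+1.-tuple A * 'I_n.+1)%type => w n) measurable.
Arguments cylinders {d} A.

(* The product over n >= 1 of the spaces A^n x [n], with the product
   sigma-algebra. *)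
Definition gewp_space (d : measure_display) (A : measurableType d) :=
  g_sigma_algebraType (cylinders A).

Section gewp.
Context {R : realType} {d d' : measure_display} {A : measurableType d}.
Context {Om : measurableType d'} (P : probability Om R).
Variables (W : forall n : nat, {RV P >-> n.+1.-tuple A})
          (eta : forall n : nat, {RV P >-> 'I_n.+1}).

Definition tail_sigma (n : nat) : set (set Om) :=
  <<s \bigcup_(k in [set k | (n <= k)%N])
        (preimage_set_system setT (W k) measurable `|`
         preimage_set_system setT (eta k.+1) measurable) >>.

Definition is_gewp : Prop := forall n : nat,
  [/\ (forall i : 'I_n.+1, P (eta n @^-1` [set i]) = (n.+1%:R^-1)%:E),
      independent_of (eta n) (tail_sigma n) &
      {ae P, forall w, W n w = erase (W n.+1 w) (eta n.+1 w)}].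

Definition gewp_path (w : Om) : gewp_space A := fun n => (W n w, eta n w).

Lemma measurable_gewp_path : measurable_fun setT gewp_path.
Proof.
apply: (@measurability _ _ Om (gewp_space A) setT gewp_path (cylinders A)) =>
  // _ [_ [n _ [B mB <-]] <-].
have mWe : measurable_fun setT (fun w => (W n w, eta n w)).
  exact: measurable_fun_pair.
by have := mWe measurableT B mB; rewrite !setTI.
Qed.

HB.instance Definition _ :=
  isMeasurableFun.Build _ _ Om (gewp_space A) gewp_path measurable_gewp_path.

Definition gewp_law : probability (gewp_space A) R := distribution P gewp_path.

End gewp.

Section gewp_laws.
Context (R : realType) {d : measure_display} (A : measurableType d).

Definition gewp_laws : set (probability (gewp_space A) R) :=
  [set mu : probability (gewp_space A) R |
    exists (d' : measure_display) (Om : measurableType d')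
      (P : probability Om R) (W : forall n : nat, {RV P >-> n.+1.-tuple A})
      (eta : forall n : nat, {RV P >-> 'I_n.+1}),
    is_gewp W eta /\ gewp_law W eta ≡μ mu].

Definition erg_gewp_laws := extreme_points gewp_laws.

End gewp_laws.
Arguments gewp_laws R {d} A.
Arguments erg_gewp_laws R {d} A.

Definition is_ergodic_gewp (R : realType) (d d' : measure_display)
    (A : measurableType d) (Om : measurableType d') (P : probability Om R)
    (W : forall n : nat, {RV P >-> n.+1.-tuple A})
    (eta : forall n : nat, {RV P >-> 'I_n.+1}) : Prop :=
  is_gewp W eta /\ erg_gewp_laws R A (gewp_law W eta).

Definition unif_second_marginal (R : realType) (d : measure_display)
    (A : measurableType d) : set (probability (A * R)%type R) :=
  [set rho : probability (A * R)%type R | forall t : R,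
    0 <= t <= 1 -> rho (setT `*` `[0, t]) = t%:E].

Section induced_process.
Context {R : realType} {d d' : measure_display} {A : measurableType d}.
Context {Om : measurableType d'} {P : probability Om R}.
Variable Z : nat -> {RV P >-> (A * R)%type}.

Definition y_word n (w : Om) : n.+1.-tuple A := [tuple (Z j w).1 | j < n.+1].
Definition u_word n (w : Om) : n.+1.-tuple R := [tuple (Z j w).2 | j < n.+1].

Definition ios_word n (w : Om) : n.+1.-tuple A := ios (y_word n w) (u_word n w).
Definition ios_eta n (w : Om) : 'I_n.+1 := last_rank (u_word n w).

Lemma measurable_y_word n : measurable_fun setT (y_word n).
Proof.
apply/measurable_fun_tnthP => i.
have -> : (fun t => tnth t i) \o y_word n = fst \o Z i.
  by apply/funext => w /=; rewrite tnth_mktuple.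
exact: measurableT_comp.
Qed.

Lemma measurable_u_word n : measurable_fun setT (u_word n).
Proof.
apply/measurable_fun_tnthP => i.
have -> : (fun t => tnth t i) \o u_word n = snd \o Z i.
  by apply/funext => w /=; rewrite tnth_mktuple.
exact: measurableT_comp.
Qed.

HB.instance Definition _ n := isMeasurableFun.Build _ _ Om (n.+1.-tuple A)
  (ios_word n) (measurable_ios (@measurable_y_word n) (@measurable_u_word n)).
HB.instance Definition _ n := isMeasurableFun.Build _ _ Om 'I_n.+1
  (ios_eta n) (measurable_last_rank (@measurable_u_word n)).

Definition ios_W n : {RV P >-> n.+1.-tuple A} := ios_word n.
Definition ios_Eta n : {RV P >-> 'I_n.+1} := ios_eta n.

End induced_process.

(* The law of the process built from an i.i.d. sequence with law rho, which up
   to ≡μ does not depend on the sequence. The default value [point] is a Dirac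
   mass and hence not the law of a GEWP: [GEWP rho] can be in
   [erg_gewp_laws R A] only if such an i.i.d. sequence exists. *)
Definition GEWP (R : realType) (d : measure_display) (A : measurableType d)
    (rho : probability (A * R)%type R) : probability (gewp_space A) R :=
  xget point [set mu | exists (d' : measure_display) (Om : measurableType d')
      (P : probability Om R) (Z : nat -> {RV P >-> (A * R)%type}),
    iid Z rho /\ gewp_law (ios_W Z) (ios_Eta Z) = mu].

(* f induces a bijection from C to E, both taken modulo ≡μ. *)
Definition law_bijection (R : realType) (d d' : measure_display)
    (S : measurableType d) (T : measurableType d')
    (C : set (probability S R)) (E : set (probability T R))
    (f : probability S R -> probability T R) : Prop :=
  [/\ (forall rho, C rho -> E (f rho)),
      (forall rho rho', C rho -> C rho' -> rho ≡μ rho' -> f rho ≡μ f rho'),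
      (forall rho rho', C rho -> C rho' -> f rho ≡μ f rho' -> rho ≡μ rho') &
      (forall mu, E mu -> exists2 rho, C rho & f rho ≡μ mu)].

(* Main.v *)
Require Import Defs.
From HB Require Import structures.
From mathcomp Require Import all_boot all_order all_algebra all_fingroup finmap.
From mathcomp Require Import all_classical all_reals all_analysis giry.
From mathcomp Require Import measurable_realfun zify ring lra.
Set Implicit Arguments.
Unset Strict Implicit.
Unset Printing Implicit Defensive.
Import Order.TTheory GRing.Theory Num.Theory.
Import numFieldNormedType.Exports.
Local Open Scope classical_set_scope.
Local Open Scope ring_scope.

(** Picture the letters as items that arrive one after another: item n is the
letter of W_n at place eta_n, inserted at that place into W_(n-1). The insertion
places eta_1, ..., eta_n determine the permutation [insertion_perm] that sends
each of the first n items to its place in W_n. In a GEWP this permutation is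
uniform and independent of the sigma-algebra F_n ([insertion_perm_uniform]).
The proof passes back and forth between GEWPs and exchangeable sequences of
pairs (letter, mark).

From sequences to GEWPs: sorting by the marks ([sorted_path]) an exchangeable
sequence whose marks are pairwise distinct gives a GEWP ([exchangeable_is_gewp]),
because the tail events do not change when item n is exchanged with an earlier
one, so that the rank of item n is as likely to be any of 1, ..., n. An i.i.d.
sequence with uniform marks has no ties ([iid_no_ties]).

From GEWPs to sequences: the mark of item i is the limit of its relative place in
W_n ([insertion_mark]). For a sorted i.i.d. sequence with uniform marks the limit
exists and gives the original marks back ([iid_insertion_mark], by a law of large
numbers). The law of the insertion places is the same for all GEWPs
([insertion_law_eq]); hence in every GEWP the limits exist almost surely, are
distinct and uniform, and sort back to the given process
([recovered_path]). The recovered sequence of pairs is exchangeable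
([recovered_exchangeable]): exchanging two of the first n items amounts to
multiplying the uniform insertion permutation by a transposition, and all else
that determines the sequence is known from F_n.

The law of a sorted i.i.d. sequence is extreme ([iid_gewp_law_extreme]): if it is
a proper mixture, each component is, up to a factor, dominated by it, and so the
exchangeable sequence recovered from the component is dominated by an i.i.d. one.
Its empirical frequencies then converge to the same constants, and
exchangeability makes it i.i.d. with the same law ([exchangeable_dominated_iid]).

Conversely an extreme law comes from an i.i.d. sequence ([extreme_iid]). Write X
for the recovered sequence and, for an event on X_0, condition on it and on its
complement: the shifted sequence X_1, X_2, ... stays exchangeable, so the
law is a mixture of two GEWP laws, which by extremality agree with it. Thus
X_0 is independent of (X_1, X_2, ...), a sequence distributed as X, and iterating
this yields an i.i.d. sequence. Injectivity holds because rho is the law of the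
first recovered item ([GEWP_recover]).

The map is defined only because i.i.d. sequences of law rho exist ([exists_iid]):
the bits at even and odd places of a fair bit sequence are independent copies of
it, a fair bit sequence is the binary expansion of a uniform point, and a quantile
function composed with a coding of A x [0, 1] into the line turns a uniform point
into a sample of rho. *)

(** * Laws of random sequences *)

Lemma measurable_preimage d d' (S : measurableType d) (T : measurableType d')
    (f : S -> T) (B : set T) :
  measurable_fun setT f -> measurable B -> measurable (f @^-1` B).
Proof. by move=> mf mB; rewrite -[X in measurable X]setTI; exact: mf. Qed.

Lemma measure_setI_full d (T : measurableType d) (R : realType)
    (P : probability T R) (A D : set T) :
  measurable A -> measurable D -> P D = 1%E -> P (A `&` D) = P A.
Proof.
move=> mA mD PD; rewrite [RHS](measureDI P mA mD).
have PDC : P (~` D) = 0%E by rewrite probability_setC // PD subee.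
rewrite [X in _ = (X + _)%E](_ : _ = 0%E) ?add0e //.
apply: (@subset_measure0 _ _ _ _ _ (~` D)) => //.
- exact: measurableD.
- exact: measurableC.
Qed.

Lemma measure_finite_partition d (T : measurableType d) (R : realType)
    (P : probability T R) (I : finType) (F : I -> set T) (C : set T) :
  (forall i, measurable (F i)) -> trivIset setT F -> C = \bigcup_i F i ->
  P C = (\sum_(i : I) P (F i))%E.
Proof.
move=> mF tF ->; rewrite measure_fin_bigcup //; last exact: finite_finset.
rewrite (fsbigE (index_enum I)).
- by apply: eq_bigl => i; rewrite in_setT.
- exact: index_enum_uniq.
- by [].
- by move=> i _ /negP[]; exact: mem_index_enum.
Qed.

Lemma measurable_set_eq d (T : measurableType d) (R : realType) (f g : T -> R) :
  measurable_fun setT f -> measurable_fun setT g ->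
  measurable [set x | f x = g x].
Proof.
move=> mf mg; have -> : [set x | f x = g x] = (fun x => f x == g x) @^-1` [set true].
  by apply/seteqP; split => x /= /eqP.
by apply: measurable_preimage => //; exact: measurable_fun_eqr.
Qed.

Lemma measure_finite_preimage d (T : measurableType d) (R : realType)
    (P : probability T R) (I : finType) (X : T -> I) (B : set I)
    (D : set T) :
  (forall i, measurable (X @^-1` [set i])) -> measurable D ->
  P (X @^-1` B `&` D) =
  (\sum_(i : I) if i \in B then P (X @^-1` [set i] `&` D) else 0)%E.
Proof.
move=> mX mD.
pose F i := if i \in B then X @^-1` [set i] `&` D else set0.
rewrite (@measure_finite_partition _ _ _ P _ F).
- by apply: eq_bigr => i _; rewrite /F; case: ifP.
- by move=> i; rewrite /F; case: ifP => // _; exact: measurableI.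
- move=> i j _ _ [w [Fi Fj]]; move: Fi Fj; rewrite /F.
  by case: ifP => _ [] // ei _; case: ifP => _ [] // ej _; exact: etrans (esym ei) ej.
- apply/seteqP; split => w /=.
    by move=> [wB wD]; exists (X w) => //; rewrite /F mem_set.
  by move=> [i _]; rewrite /F; case: ifPn => //; rewrite inE => iB [/= -> ?].
Qed.

(** The coordinates may live in different spaces, so that the space of pairs
(W_n, eta_n) and that of the insertion places are instances as well as the space
of sequences in one fixed space. *)
Section sequence_space.
Context {d : measure_display} (T : nat -> measurableType d).

Definition coordinate_sets : set (set (forall n, T n)) :=
  \bigcup_n preimage_set_system setT (fun x : forall n, T n => x n) measurable.

Definition seq_space := g_sigma_algebraType coordinate_sets.

Definition cylinder n (B : forall k, set (T k)) : set (forall n, T n) :=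
  [set x | forall k, (k < n)%N -> B k (x k)].

Lemma measurable_coordinate n : measurable_fun setT (fun x : seq_space => x n).
Proof.
move=> _ B mB; apply: sub_sigma_algebra; exists n => //; exists B => //.
Qed.
Arguments measurable_coordinate n : clear implicits.

Lemma measurable_seq d' (Om : measurableType d') (X : Om -> seq_space) :
  (forall n, measurable_fun setT (fun w => X w n)) -> measurable_fun setT X.
Proof.
move=> mX; apply: (@measurability _ _ Om seq_space setT X coordinate_sets) =>
  // _ [_ [n _ [B mB <-]] <-].
by have := mX n measurableT B mB; rewrite !setTI.
Qed.

Lemma measurable_cylinder n (B : forall k, set (T k)) :
  (forall k, measurable (B k)) -> measurable (cylinder n B : set seq_space).
Proof.
move=> mB.
have -> : cylinder n B = \bigcap_(k in `I_n) ((fun x : seq_space => x k) @^-1` B k).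
  by apply/seteqP; split.
apply: bigcap_measurableType => k _.
exact: (measurable_preimage (measurable_coordinate k)).
Qed.

Lemma cylinder_setI n m (B C : forall k, set (T k)) :
  cylinder n B `&` cylinder m C =
  cylinder (maxn n m) (fun k => (if (k < n)%N then B k else setT) `&`
                                (if (k < m)%N then C k else setT)).
Proof.
apply/seteqP; split => x /=.
  move=> [xB xC] k _; split; case: ifPn => // kn; [exact: xB|exact: xC].
by move=> h; split => k kn; have := h k; rewrite leq_max kn ?orbT => /(_ isT)[].
Qed.

Lemma seq_space_generated : @measurable _ seq_space =
  <<s [set S | exists n B, (forall k, measurable (B k)) /\ S = cylinder n B] >>.
Proof.
apply/seteqP; split.
  apply: smallest_sub; first exact: smallest_sigma_algebra.
  move=> _ [n _ [B mB <-]]; apply: sub_sigma_algebra.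
  exists n.+1, (dfwith (fun k => setT) n B); split.
    by move=> k; case: dfwithP => //= j _; exact: measurableT.
  rewrite setTI; apply/seteqP; split=> x /=.
    by move=> xB k _; case: dfwithP.
  by move=> /(_ n); rewrite ltnS leqnn dfwithin; exact.
apply: smallest_sub; first exact: sigma_algebra_measurable.
by move=> _ [n [B [mB ->]]]; exact: measurable_cylinder.
Qed.

End sequence_space.
Arguments measurable_coordinate {d T} n.

Section laws_of_sequences.
Context {R : realType} {d : measure_display} (T : nat -> measurableType d).
Context {d1 d2 : measure_display} {Om1 : measurableType d1}.
Context {Om2 : measurableType d2}.
Variables (P1 : probability Om1 R) (P2 : probability Om2 R).
Variables (X1 : Om1 -> seq_space T) (X2 : Om2 -> seq_space T).
Hypotheses (mX1 : measurable_fun setT X1) (mX2 : measurable_fun setT X2).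

(** Cylinders are stable under intersection and generate the sigma-algebra, so the
pi-lambda theorem applies. All identities between laws of sequences below go
through this lemma. *)
Lemma seq_law_eq :
  (forall n (B : forall k, set (T k)), (forall k, measurable (B k)) ->
    P1 (X1 @^-1` cylinder n B) = P2 (X2 @^-1` cylinder n B)) ->
  forall C, measurable C -> P1 (X1 @^-1` C) = P2 (X2 @^-1` C).
Proof.
move=> h C mC.
have m1 D : measurable D -> measurable (X1 @^-1` D).
  exact: measurable_preimage.
have m2 D : measurable D -> measurable (X2 @^-1` D).
  exact: measurable_preimage.
move: C mC; rewrite seq_space_generated.
apply: (@dynkin_induction _ (seq_space T) _
  [set C | P1 (X1 @^-1` C) = P2 (X2 @^-1` C)] (seq_space_generated T)).
- move=> _ _ [n [B [mB ->]]] [m [D [mD ->]]]; rewrite cylinder_setI.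
  eexists _, _; split; last by [].
  by move=> k; apply: measurableI; case: ifPn => // _; exact: measurableT.
- by rewrite /= !preimage_setT !probability_setT.
- by move=> _ [n [B [mB ->]]]; exact: h.
- move=> S mS; rewrite /= -!preimage_setC => PE.
  by rewrite (probability_setC P1 (m1 _ mS)) (probability_setC P2 (m2 _ mS)) PE.
- move=> F mF tF hF; rewrite /= !preimage_bigcup (measure_bigcup P1) ?(measure_bigcup P2)//=.
  + by apply: eq_eseriesr => i _; exact: hF.
  + by move=> i _; exact: m2.
  + by apply/trivIsetP => i j _ _ ij; rewrite -preimage_setI (trivIsetP.1 tF) // preimage_set0.
  + by move=> i _; exact: m1.
  + by apply/trivIsetP => i j _ _ ij; rewrite -preimage_setI (trivIsetP.1 tF) // preimage_set0.
Qed.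

End laws_of_sequences.

Section processes.
Context {d : measure_display} {T : measurableType d} {Om : Type}.

Definition path (Z : nat -> Om -> T) : Om -> seq_space (fun _ : nat => T) :=
  fun w n => Z n w.

End processes.

Lemma measurable_path d (T : measurableType d) d' (Om : measurableType d')
  (Z : nat -> Om -> T) :
  (forall n, measurable_fun setT (Z n)) -> measurable_fun setT (path Z).
Proof. by move=> mZ; apply: measurable_seq. Qed.

Definition swapn (i j n : nat) : nat :=
  if n == i then j else if n == j then i else n.

Lemma swapnK i j : involutive (swapn i j).
Proof.
move=> n; rewrite /swapn; case: (eqVneq n i) => [->|ni].
  by rewrite eqxx; case: eqVneq.
by case: (eqVneq n j) => [->|nj]; [rewrite eqxx|rewrite (negbTE ni) (negbTE nj)].
Qed.

Lemma swapn_inj i j : injective (swapn i j).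
Proof. exact: inv_inj (@swapnK i j). Qed.

Section exchangeable.
Context {R : realType} {d : measure_display} {T : measurableType d}.
Context {d' : measure_display} {Om : measurableType d'}.
Variable (P : probability Om R).
Implicit Types Z : nat -> Om -> T.

(** Transpositions generate the finite permutations, so only they are asked for. *)
Definition exchangeable Z := forall i j (C : set (seq_space (fun _ : nat => T))),
  measurable C ->
  P (path (fun n => Z (swapn i j n)) @^-1` C) = P (path Z @^-1` C).

(** The product rule on cylinders; [iid_lawP] shows that it is equivalent to being
i.i.d. It depends on the law of the sequence only. *)
Definition iid_law Z (rho : probability T R) :=
  forall n (B : nat -> set T), (forall k, measurable (B k)) ->
  P (path Z @^-1` cylinder (T := fun _ : nat => T) n B) =
    (\prod_(k < n) rho (B k))%E.

Lemma measurable_reindex (s : nat -> nat) :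
  measurable_fun setT (fun x : seq_space (fun _ : nat => T) =>
     (fun n => x (s n)) : seq_space (fun _ : nat => T)).
Proof. by apply: measurable_seq => n; exact: measurable_coordinate. Qed.

(** An injection s need not permute any initial segment (the shift does not), but
on each initial segment it agrees with a product of transpositions, and cylinders
see only initial segments. *)
Lemma exchangeable_inj Z (s : nat -> nat) : (forall n, measurable_fun setT (Z n)) ->
  exchangeable Z -> injective s -> 
  forall C, measurable C ->
  P (path (fun n => Z (s n)) @^-1` C) = P (path Z @^-1` C).
Proof.
move=> mZ eZ sinj.
have [t [tinj ts tE]] : exists t : nat -> nat -> nat,
  [/\ (forall N, injective (t N)), (forall N k, (k < N)%N -> t N k = s k) &
  forall N C, measurable C ->
  P (path (fun n => Z (t N n)) @^-1` C) = P (path Z @^-1` C)].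
  (* Once t agrees with s below N, compose it with the transposition of t N and
     s N; the values below N are not affected since t and s are injective. *)
  pose t := fix t N := if N is N'.+1 then
    swapn (t N' N') (s N') \o t N' else id.
  have tinj N : injective (t N).
    elim: N => [//|N IH]/=; exact: inj_comp (@swapn_inj _ _) IH.
  exists t; split => //.
    elim=> [//|N IH] k; rewrite ltnS leq_eqVlt => /predU1P[->|kN] /=.
      by rewrite /swapn eqxx.
    rewrite /swapn (inj_eq (tinj N)) (ltn_eqF kN) IH // (inj_eq sinj).
    by rewrite (ltn_eqF kN).
  elim=> [//|N IH] C mC /=.
  rewrite -(IH C mC).
  pose f := fun x : seq_space (fun _ : nat => T) =>
     (fun n => x (t N n)) : seq_space (fun _ : nat => T).
  exact: (eZ (t N N) (s N) (f @^-1` C) (measurable_preimage (measurable_reindex _) mC)).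
apply: seq_law_eq; [exact: measurable_path|exact: measurable_path|].
move=> n B mB; rewrite -(tE n); last exact: measurable_cylinder.
by congr (P _); apply/seteqP; split => w /= h k kn; have := h k kn; rewrite /path ts.
Qed.

End exchangeable.

Section iid.
Context {R : realType} {d : measure_display} {T : measurableType d}.
Context {d' : measure_display} {Om : measurableType d'}.
Variables (P : probability Om R).

(** Mutual independence is a product rule over finite sets of indices; injectivity
of s makes the first n reindexed terms such a set. *)
Lemma iid_law_reindex (Z : nat -> {RV P >-> T}) (rho : probability T R) (s : nat -> nat) :
  iid Z rho -> injective s -> iid_law P (fun n => Z (s n)) rho.
Proof.
move=> [mi Zrho] sinj n B mB.
pose l := [seq s k | k <- iota 0 n].
pose J : {fset nat} := [fset j in l]%fset.
have JE : perm_eq J l.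
  apply: uniq_perm; [exact: fset_uniq|by rewrite map_inj_uniq // iota_uniq|].
  by move=> j; rewrite in_fset.
pose B' j := B (index j l).
have B'E k : (k < n)%N -> B' (s k) = B k.
  by move=> kn; rewrite /B' index_map // -[X in index X _]add0n -(nth_iota 0 0 kn) index_uniq ?iota_uniq ?size_iota.
have := mi J B' (fun=> mB _).
have -> : \bigcap_(j in [set` J]) (Z j @^-1` B' j) =
   path (fun n => Z (s n)) @^-1` cylinder (T := fun _ : nat => T) n B.
  apply/seteqP; split => w /= h.
    move=> k kn; rewrite /path -B'E //; apply: h => /=.
    by rewrite in_fset map_f // mem_iota.
  move=> j /=; rewrite in_fset => /mapP[k]; rewrite mem_iota add0n => /= kn ->.
  by rewrite B'E //; exact: h.
move=> ->; rewrite (perm_big _ JE) /= big_map.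
have -> : iota 0 n = index_iota 0 n by rewrite /index_iota subn0.
rewrite big_mkord; apply: eq_bigr => k _.
by rewrite B'E //; exact: (Zrho (s k) _ (mB k)).
Qed.

Lemma iid_lawP (Z : nat -> {RV P >-> T}) (rho : probability T R) :
  iid Z rho <-> iid_law P Z rho.
Proof.
split=> [iZ|iZ]; first exact: (iid_law_reindex iZ (s := id)).
have mar j : distribution P (Z j) ≡μ rho.
  move=> B mB /=.
  have := iZ j.+1 (fun k => if k == j then B else setT).
  rewrite big_ord_recr/= eqxx big1 ?mul1e; last first.
    by move=> i _; rewrite ltn_eqF // probability_setT.
  move=> <-; last by move=> k; case: ifP.
  congr (P _); apply/seteqP; split => w /=.
    by move=> h k _; case: eqP => // ->.
  by move=> /(_ j (leqnn _)); rewrite eqxx.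
split => // J B mB.
pose n := (\max_(j <- J) j).+1.
have Jn j : j \in J -> (j < n)%N by move=> jJ; rewrite ltnS; exact: leq_bigmax_seq.
pose B' k := if k \in J then B k else setT.
have := iZ n B' (fun k => _).
have -> : path Z @^-1` cylinder (T := fun _ : nat => T) n B' =
  \bigcap_(j in [set` J]) (Z j @^-1` B j).
  apply/seteqP; split => w /= h.
    by move=> j /= jJ; have := h j (Jn j jJ); rewrite /B' jJ.
  by move=> k kn; rewrite /B'; case: ifPn => // kJ; exact: h.
move=> ->; last by move=> k; rewrite /B'; case: ifP.
rewrite [RHS](eq_big_seq (fun j => rho (B j))); last by move=> j _; exact: (mar j _ (mB j)).
rewrite (eq_bigr (fun k : 'I_n => if val k \in J then rho (B k) else 1%E)); last first.
  by move=> k _; rewrite /B'; case: ifP => // _; rewrite probability_setT.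
rewrite -big_mkcond /= -(big_mkord (fun k => k \in J) (fun k => rho (B k))).
rewrite -big_filter; apply: perm_big; apply: uniq_perm.
- by rewrite filter_uniq // iota_uniq.
- exact: fset_uniq.
- move=> j; rewrite mem_filter mem_index_iota /=.
  by apply: andb_idr => /Jn.
Qed.

Lemma iid_pair (Z : nat -> {RV P >-> T}) (rho : probability T R) k l (B C : set T) :
  iid Z rho -> k != l -> measurable B -> measurable C ->
  P (Z k @^-1` B `&` Z l @^-1` C) = (rho B * rho C)%E.
Proof.
move=> [mi law] kl mB mC.
pose D j := if j == k then B else C.
have mD j : measurable (D j) by rewrite /D; case: ifP.
have Dl : D l = C by rewrite /D eq_sym (negbTE kl).
have Dk : D k = B by rewrite /D eqxx.
have := mi [fset k; l]%fset D mD; rewrite big_fsetU1 ?inE //= big_seq_fset1.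
have -> : P (Z k @^-1` D k) = rho B by rewrite Dk; exact: (law k _ mB).
have -> : P (Z l @^-1` D l) = rho C by rewrite Dl; exact: (law l _ mC).
move=> <-; congr (P _); apply/seteqP; split => w /=.
  by move=> [Bw Cw] j /=; rewrite !inE => /orP[] /eqP ->; rewrite ?Dk ?Dl.
move=> h; have := h k; have := h l; rewrite /= !inE !eqxx orbT Dk Dl.
by move=> /(_ isT) Cw /(_ isT) Bw.
Qed.

Lemma iid_exchangeable (Z : nat -> {RV P >-> T}) (rho : probability T R) :
  iid Z rho -> exchangeable P Z.
Proof.
move=> iZ i j; apply: seq_law_eq.
- by apply: measurable_path => n; exact: measurable_funP.
- by apply: measurable_path => n; exact: measurable_funP.
- move=> n B mB; rewrite (iid_law_reindex iZ (@swapn_inj i j)) //.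
  by move/iid_lawP : iZ => ->.
Qed.

End iid.

Lemma iid_law_eq (R : realType) d (T : measurableType d) d1 d2 
  (Om1 : measurableType d1) (Om2 : measurableType d2) (P1 : probability Om1 R)
  (P2 : probability Om2 R) (Z1 : nat -> Om1 -> T) (Z2 : nat -> Om2 -> T)
  (rho : probability T R) :
  (forall n, measurable_fun setT (Z1 n)) ->
  (forall n, measurable_fun setT (Z2 n)) ->
  iid_law P1 Z1 rho -> iid_law P2 Z2 rho ->
  forall C, measurable C -> P1 (path Z1 @^-1` C) = P2 (path Z2 @^-1` C).
Proof.
move=> m1 m2 i1 i2; apply: seq_law_eq; [exact: measurable_path|exact: measurable_path|].
by move=> n B mB; rewrite i1 // i2.
Qed.

(** * Binary digits of a uniform point *)

(** If a random point w yields a sample f w and, independently of it, a copy g w of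
itself, then iterating g yields an i.i.d. sequence of samples. This is how a single
probability space carries an i.i.d. sequence: it is applied to the binary digits
of a uniform point, and then to samplers fed by fair bits. *)
Lemma iid_law_split (R : realType) d d' (T : measurableType d)
    (Om : measurableType d') (P : probability Om R) (rho : probability T R)
    (f : Om -> T) (g : Om -> Om) :
  measurable_fun setT f -> measurable_fun setT g ->
  (forall B C, measurable B -> measurable C ->
    P (f @^-1` B `&` g @^-1` C) = (rho B * P C)%E) ->
  iid_law P (fun n w => f (iter n g w)) rho.
Proof.
move=> mf mg fg n B mB.
have mZ k : measurable_fun setT (fun w => f (iter k g w)).
  apply: (measurableT_comp mf); elim: k => [|k IH]; first exact: measurable_id.
  exact: (measurableT_comp mg).
elim: n B mB => [|n IH] B mB.
  rewrite big_ord0 -(@probability_setT _ _ _ P); congr (P _).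
  by apply/seteqP; split.
rewrite big_ord_recl -(IH (fun k => B k.+1)) // -fg //; last first.
  exact: measurable_preimage (measurable_path mZ) (measurable_cylinder _ _).
congr (P _); apply/seteqP; split => w /= h.
  split; first exact: (h 0).
  by move=> k kn; have := h k.+1 kn; rewrite /path iterSr.
by case: h => h0 h [|k] kn //; rewrite /path iterSr; exact: h.
Qed.

Section unit_interval.
Context {R : realType}.

(** The interval is half-open so that the doubling map sends each of its halves
[0, 1/2[ and [1/2, 1[ onto the whole of it. *)
Definition unit_law (B : set R) : \bar R := lebesgue_measure (B `&` `[0, 1[).

Let unit_law0 : unit_law set0 = 0%E.
Proof. by rewrite /unit_law set0I measure0. Qed.

Let unit_law_ge0 B : (0 <= unit_law B)%E.
Proof. exact: measure_ge0. Qed.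

Let unit_law_additive : semi_sigma_additive unit_law.
Proof. exact: (@measure_semi_sigma_additive _ _ _ (mrestr lebesgue_measure (measurable_itv `[0, 1[))). Qed.

HB.instance Definition _ := isMeasure.Build _ _ _ unit_law
  unit_law0 unit_law_ge0 unit_law_additive.

Let unit_lawT : unit_law setT = 1%E.
Proof. by rewrite /unit_law setTI lebesgue_measure_itv /= lte_fin ltr01 oppr0 adde0. Qed.

HB.instance Definition _ := Measure_isProbability.Build _ _ _ unit_law unit_lawT.

Lemma unit_law_ray (t : R) : 0 <= t <= 1 -> unit_law `]-oo, t] = t%:E.
Proof.
move=> /andP[t0 t1]; rewrite /unit_law.
have [t_lt1|t_ge1] := ltP t 1.
  have -> : `]-oo, t] `&` `[0, 1[ = `[0, t]%classic :> set R.
    apply/seteqP; split => x /=; rewrite !in_itv /=.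
      by move=> [xt /andP[-> _]].
    by move=> /andP[-> xt]; rewrite xt (le_lt_trans xt).
  rewrite lebesgue_measure_itv /= lte_fin oppr0 adde0.
  by case: ltgtP t0 => // <-.
have -> : t = 1 by apply/eqP; rewrite eq_le t1.
rewrite (_ : `]-oo, 1] `&` `[0, 1[ = `[0, 1[%classic :> set R).
  by rewrite lebesgue_measure_itv /= lte_fin ltr01 oppr0 adde0.
apply/seteqP; split => x /=; rewrite !in_itv /=; first by case.
by move=> /andP[-> x1]; rewrite (ltW x1).
Qed.

Lemma unit_law01 : unit_law `[0, 1] = 1%E.
Proof.
rewrite /unit_law (_ : _ `&` _ = `[0, 1[%classic).
  by rewrite lebesgue_measure_itv /= lte_fin ltr01 oppr0 adde0.
apply/seteqP; split => x /=; rewrite !in_itv /=; first by case.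
by move=> /andP[-> x1]; rewrite (ltW x1).
Qed.

Lemma lebesgue_affine (c : R) (C : set R) : measurable C ->
  (2%:E * lebesgue_measure [set x : R | C (2 * x - c)%R])%E = lebesgue_measure C.
Proof.
have mT : measurable_fun setT (fun x : R => 2 * x - c : measurableTypeR R).
  by apply: measurable_funB => //; exact: measurable_funM.
move=> mC; apply/esym.
pose mu := mscale (NngNum (ler0n R 2))
  (measure_function_pushforward__canonical__measure_function_Measure
    (@lebesgue_measure R) mT).
suff -> : lebesgue_measure C = mu C by [].
apply: (@lebesgue_measure_unique R mu) => // _ [[a b]] _ <-.
pose I : set R := `](a + c) / 2, (b + c) / 2]%classic.
transitivity (2%:E * lebesgue_measure I)%E; rewrite /I.
  rewrite !lebesgue_measure_itv /= !lte_fin ltr_pM2r ?invr_gt0 // ltrD2r.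
  case: ifP => _; last by rewrite mule0.
  by rewrite -!EFinB -EFinM; congr _%:E; field.
congr (_ * lebesgue_measure _)%E; rewrite /preimage.
by apply/seteqP; split => x /=; rewrite !in_itv /= => /andP[h1 h2]; apply/andP; split; lra.
Qed.

Definition high (x : R) : bool := 1 / 2 <= x.
(** With the digits 0 and q - 1 in base q, [step q] is the shift on expansions. For
q = 2 it is the doubling map on binary expansions; for q = 3 the expansions have
the digits 0 and 2, as in the Cantor set. *)
Definition step (q x : R) : R := q * x - (q - 1) * (high x)%:R.
Definition digits (q x : R) : seq_space (fun _ : nat => bool) :=
  fun k => high (iter k (step q) x).

Lemma measurable_high : measurable_fun setT high.
Proof. exact: measurable_fun_ler. Qed.

Lemma measurable_step q : measurable_fun setT (step q).
Proof.
apply: measurable_funB; first exact: measurable_funM.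
apply: measurable_funM => //.
have -> : (fun x : R => (high x)%:R : R) = \1_(`[(1 / 2), +oo[).
  by apply/funext => x; rewrite indicE mem_setE in_itv /= andbT.
exact: measurable_indic.
Qed.

Lemma measurable_digits q : measurable_fun setT (digits q).
Proof.
apply: (@measurable_seq _ (fun=> bool)) => n; rewrite /digits.
apply: (measurableT_comp measurable_high).
elim: n => [|n IH]; first exact: measurable_id.
exact: (measurableT_comp (measurable_step q)).
Qed.

HB.instance Definition _ := isMeasurableFun.Build _ _ _ _ high measurable_high.
Definition digit_law : probability bool R := distribution unit_law high.

(** The doubling map sends each half affinely onto the unit interval, so the image
is uniform whichever half the point lies in. *)
Lemma unit_law_step (B : set bool) (C : set R) : measurable B -> measurable C ->
  unit_law (high @^-1` B `&` step 2 @^-1` C) = (digit_law B * unit_law C)%E.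
Proof.
have half (c : bool) (C' : set R) : measurable C' ->
    unit_law (high @^-1` [set c] `&` step 2 @^-1` C') = ((1 / 2)%:E * unit_law C')%E.
  move=> mC; rewrite {2}/unit_law -(lebesgue_affine c%:R); last exact: measurableI.
  rewrite muleA -EFinM mulfVK // mul1e /unit_law; congr lebesgue_measure.
  apply/seteqP; split => x /=; rewrite !in_itv /= /step /high.
    case: c => /= -[[]] hx h /andP[x0 x1].
      rewrite hx mulr1 in h.
      by split; [move: h; congr C'; rewrite /=; ring|apply/andP; split; lra].
    move/negbT: hx; rewrite -ltNge => hx; rewrite leNgt hx mulr0 subr0 /= in h.
    by split; [rewrite subr0|apply/andP; split; lra].
  case: c => /= -[h /andP[x0 x1]].
    have hx : 1 / 2 <= x by lra.
    by rewrite hx; do !split => //; [move: h; congr C'; rewrite /=; ring|apply/andP; split; lra].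
  have hx : (1 / 2 <= x) = false by apply/negbTE; rewrite -ltNge; lra.
  by rewrite hx; do !split => //; [move: h; congr C'; rewrite /=; ring|apply/andP; split; lra].
move=> mB mC.
have mh c : measurable (high @^-1` [set c]) by exact: (measurable_preimage measurable_high).
have split_law D : measurable D -> unit_law (high @^-1` B `&` D) =
    (\sum_(c : bool) if c \in B then unit_law (high @^-1` [set c] `&` D) else 0)%E.
  by move=> mD; exact: (measure_finite_preimage (unit_law : probability R R) B mh mD).
have mS := measurable_preimage (measurable_step 2) mC.
rewrite split_law // /digit_law /distribution /pushforward -[X in (unit_law X * _)%E]setIT.
rewrite split_law // ge0_sume_distrl; last by move=> c _; case: ifP.
apply: eq_bigr => c _; case: ifP => _; last by rewrite mul0e.
rewrite half // -[X in (unit_law (_ `&` X))](preimage_setT (step 2)) half //.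
by rewrite unit_lawT mule1.
Qed.

Local Notation bits := (seq_space (fun _ : nat => bool)).

HB.instance Definition _ q :=
  isMeasurableFun.Build _ _ _ _ (digits q) (measurable_digits q).
Definition bit_law : probability bits R := distribution unit_law (digits 2).

Lemma bit_law_cylinder n (B : nat -> set bool) :
  bit_law (cylinder (T := fun _ : nat => bool) n B) = (\prod_(k < n) digit_law (B k))%E.
Proof.
have := @iid_law_split R _ _ _ _ unit_law digit_law high (step 2) measurable_high
  (measurable_step 2) unit_law_step n B.
by apply => k.
Qed.

Definition evens (c : bits) : bits := fun k => c k.*2.
Definition odds (c : bits) : bits := fun k => c k.*2.+1.
Definition interleave (c : bits * bits) : bits :=
  fun k => if odd k then c.2 k./2 else c.1 k./2.

Lemma evens_interleave c : evens (interleave c) = c.1.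
Proof. by apply/funext => k; rewrite /evens /interleave odd_double doubleK. Qed.

Lemma odds_interleave c : odds (interleave c) = c.2.
Proof.
by apply/funext => k; rewrite /odds /interleave /= odd_double uphalf_double.
Qed.

Lemma measurable_evens : measurable_fun setT evens.
Proof. exact: (measurable_reindex double). Qed.

Lemma measurable_odds : measurable_fun setT odds.
Proof. exact: (measurable_reindex (fun k => k.*2.+1)). Qed.

Lemma measurable_interleave : measurable_fun setT interleave.
Proof.
apply: (@measurable_seq _ (fun=> bool)) => n; rewrite /interleave.
case: (odd n).
  exact: (measurableT_comp (measurable_coordinate n./2) measurable_snd).
exact: (measurableT_comp (measurable_coordinate n./2) measurable_fst).
Qed.

Lemma prod_double n (F : nat -> \bar R) :
  (\prod_(k < n.*2) F k = \prod_(j < n) F j.*2 * \prod_(j < n) F j.*2.+1)%E.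
Proof.
elim: n => [|n IH]; first by rewrite !big_ord0 mule1.
rewrite doubleS !big_ord_recr /= IH -!muleA; congr (_ * _)%E.
by rewrite muleCA.
Qed.

(** Interleaving two independent fair bit sequences gives a fair bit sequence, whose
even and odd parts are the two given ones. *)
Lemma bit_law_evens_odds C1 C2 : measurable C1 -> measurable C2 ->
  bit_law (evens @^-1` C1 `&` odds @^-1` C2) = (bit_law C1 * bit_law C2)%E.
Proof.
move=> mC1 mC2; rewrite -(@product_measure1E _ _ _ _ _ bit_law bit_law) //.
pose P2 : probability (bits * bits)%type R := (bit_law \x bit_law)%E.
have mC : measurable (evens @^-1` C1 `&` odds @^-1` C2).
  apply: measurableI; first exact: measurable_preimage measurable_evens _.
  exact: measurable_preimage measurable_odds _.
have := @seq_law_eq R _ (fun=> bool) _ _ _ _ bit_law P2 id interleave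
  (@measurable_id _ _ setT) measurable_interleave _ _ mC.
rewrite preimage_id => ->.
  congr (P2 _); apply/seteqP; split => c /=.
    by rewrite evens_interleave odds_interleave.
  by rewrite evens_interleave odds_interleave.
move=> n B mB; rewrite preimage_id.
(* A cylinder on n bits is padded to one on 2n bits, so that it splits into n
   even and n odd coordinates. *)
pose B' k := if (k < n)%N then B k else setT.
have -> : cylinder (T := fun=> bool) n B = cylinder (T := fun=> bool) n.*2 B'.
  apply/seteqP; split => c /= h k kn; first by rewrite /B'; case: ifPn => // /h.
  have := h k; rewrite /B' kn; apply; lia.
have -> : interleave @^-1` cylinder (T := fun=> bool) n.*2 B' =
    cylinder (T := fun=> bool) n (fun k => B' k.*2) `*`
    cylinder (T := fun=> bool) n (fun k => B' k.*2.+1).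
  apply/seteqP; split => c /=.
    move=> h; split => k kn.
      by have := h k.*2; rewrite /interleave odd_double doubleK; apply; lia.
    by have := h k.*2.+1; rewrite /interleave /= odd_double uphalf_double; apply; lia.
  move=> [h1 h2] k kn; rewrite /interleave; case: ifPn => ok.
    have := h2 k./2; rewrite (_ : k./2.*2.+1 = k); last by lia.
    by apply; lia.
  have := h1 k./2; rewrite (_ : k./2.*2 = k); last by lia.
  by apply; lia.
rewrite [LHS]bit_law_cylinder (prod_double n (fun k => digit_law (B' k))).
rewrite -(bit_law_cylinder n (fun k => B' k.*2)) -(bit_law_cylinder n (fun k => B' k.*2.+1)).
by apply/esym/product_measure1E; apply: measurable_cylinder.
Qed.

Definition partial_value (q : R) (c : bits) n : R :=
  \sum_(k < n) (q - 1) * (c k)%:R / q ^+ k.+1.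
Definition value (q : R) (c : bits) : R := limn (partial_value q c).
Definition shift (c : bits) : bits := fun k => c k.+1.

Lemma partial_valueS q c n : q != 0 -> partial_value q c n.+1 =
  ((q - 1) * (c 0)%:R + partial_value q (shift c) n) / q.
Proof.
move=> q0; rewrite /partial_value big_ord_recl [RHS]mulrDl expr1; congr (_ + _).
rewrite mulr_suml; apply: eq_bigr => k _; rewrite /shift.
by rewrite [q ^+ (bump 0 k).+1]exprS invfM; ring.
Qed.

Lemma partial_value_bounds q c n : 1 < q -> 0 <= partial_value q c n <= 1.
Proof.
move=> q1; have q0 : 0 < q by lra.
elim: n c => [|n IH] c; first by rewrite /partial_value big_ord0 lexx ler01.
rewrite partial_valueS ?gt_eqF // ler_pdivlMr // ler_pdivrMr // mul0r mul1r.
have /andP[h0 h1] := IH (shift c).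
have : 0 <= (q - 1) * (c 0)%:R <= q - 1 by case: (c 0) => /=; lra.
by lra.
Qed.

Lemma value_cvg q c : 1 < q -> partial_value q c n @[n --> \oo] --> value q c.
Proof.
move=> q1; have q0 : 0 < q by lra.
apply: nondecreasing_is_cvgn.
  apply/nondecreasing_seqP => n; rewrite /partial_value big_ord_recr /= lerDl.
  by apply: divr_ge0; [apply: mulr_ge0 => //; rewrite subr_ge0 ltW|rewrite exprn_ge0 // ltW].
by exists 1 => _ [n _ <-]; have /andP[] := partial_value_bounds c n q1.
Qed.

Lemma value_rec q c : 1 < q -> value q c = ((q - 1) * (c 0)%:R + value q (shift c)) / q.
Proof.
move=> q1; rewrite {1}/value; apply/cvg_lim => //.
rewrite -cvg_shiftS /=.
have -> : (fun n => partial_value q c n.+1) =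
   fun n => ((q - 1) * (c 0)%:R + partial_value q (shift c) n) / q.
  by apply/funext => n; rewrite partial_valueS // gt_eqF // (lt_trans ltr01).
apply: cvgM; [apply: cvgD; [exact: cvg_cst|exact: value_cvg]|exact: cvg_cst].
Qed.

Lemma value_bounds q c : 1 < q -> 0 <= value q c <= 1.
Proof.
move=> q1; apply/andP; split.
  apply: limr_ge; first by apply/cvg_ex; eexists; exact: value_cvg.
  by apply: nearW => n; have /andP[] := partial_value_bounds c n q1.
apply: limr_le; first by apply/cvg_ex; eexists; exact: value_cvg.
by apply: nearW => n; have /andP[] := partial_value_bounds c n q1.
Qed.

Lemma measurable_value q : 1 < q -> measurable_fun setT (value q).
Proof.
move=> q1; apply: (@measurable_fun_cvg _ _ _ _ (fun n c => partial_value q c n)).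
  move=> n; apply: measurable_sum => k; apply: measurable_funM => //.
  apply: measurable_funM => //.
  apply: (measurableT_comp (f := fun b : bool => b%:R : R)) => //.
  exact: measurable_coordinate.
by move=> c _; exact: value_cvg.
Qed.

Lemma digits_expansion q x n : q != 0 ->
  x = partial_value q (digits q x) n + iter n (step q) x / q ^+ n.
Proof.
move=> q0; elim: n => [|n IH]; first by rewrite /partial_value big_ord0 add0r expr0 divr1.
rewrite {1}IH /partial_value big_ord_recr /= -addrA; congr (_ + _).
rewrite /step /digits exprS; field.
by rewrite q0 expf_neq0.
Qed.

(** The remainder after n binary digits is an iterate of the doubling map divided
by 2^n, and the iterates stay in [0, 1]. *)
Lemma value_digits2 x : 0 <= x <= 1 -> value 2 (digits 2 x) = x.
Proof.
move=> x01; have q1 : 1 < 2 :> R by rewrite ltr1n.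
rewrite /value; apply/cvg_lim => //.
have it01 n : 0 <= iter n (step 2) x <= 1.
  elim: n => [//|n]; rewrite iterS /step /high; move: (iter n _ x) => y y01.
  by case: (leP (1 / 2) y) => h /=; lra.
apply/cvgrPdist_le => e e0.
have := @cvg_geometric R 1 (1 / 2); rewrite ger0_norm; last by lra.
move=> /(_ ltac:(lra)) /cvgrPdist_le /(_ e e0); apply: filterS => n.
rewrite sub0r normrN /geometric /= mul1r => h; apply: le_trans h.
rewrite {1}(@digits_expansion 2 x n) ?pnatr_eq0 // addrC addKr.
have /andP[h0 h1] := it01 n; have p0 : 0 <= (2 ^+ n)^-1 :> R by rewrite invr_ge0 exprn_ge0.
by rewrite mul1r exprVn !ger0_norm // ?mulr_ge0 // ler_piMl.
Qed.

(** A Cantor expansion lies in [0, 1/3] or in [2/3, 1] according to its first digit,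
so that all digits can be read off the value. Binary expansions have no such gap:
this is why sequences of bits are coded in base 3. *)
Lemma digits3_value c : digits 3 (value 3 c) = c.
Proof.
have q1 : 1 < 3 :> R by rewrite ltr1n.
have hE c' : high (value 3 c') = c' 0.
  rewrite /high value_rec //; have := value_bounds (shift c') q1.
  by case: (c' 0) => /= h; [apply/idP|apply/negbTE; rewrite -ltNge]; lra.
have sE c' : step 3 (value 3 c') = value 3 (shift c').
  by rewrite /step hE [in LHS]value_rec //; field.
apply/funext => k; rewrite /digits.
have -> : iter k (step 3) (value 3 c) = value 3 (iter k shift c).
  by elim: k => [//|k IH]; rewrite iterS IH sE.
rewrite hE; suff -> : forall m, iter k shift c m = c (k + m)%N by rewrite addn0.
by elim: k => [//|k IH] m; rewrite iterS /shift IH addnS addSn.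
Qed.

Lemma bit_law_value (B : set R) : measurable B ->
  bit_law (value 2 @^-1` B) = unit_law B.
Proof.
move=> mB; rewrite /bit_law /distribution /pushforward.
have q1 : 1 < 2 :> R by rewrite ltr1n.
have m01 : measurable (`[0, 1]%classic : set R) by exact: measurable_itv.
have mV : measurable (digits 2 @^-1` (value 2 @^-1` B)).
  apply: (measurable_preimage (measurable_digits 2)).
  exact: (measurable_preimage (measurable_value q1)).
have full D : measurable D -> unit_law D = unit_law (D `&` `[0, 1]).
  move=> mD; apply/esym.
  exact: (measure_setI_full (P := unit_law : probability R R) mD m01 unit_law01).
apply: etrans (full _ mV) _; apply: etrans _ (esym (full _ mB)).
congr unit_law; apply/seteqP; split => x /= [h x01]; split => //; move: h;
  by rewrite value_digits2.
Qed.

End unit_interval.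

(** * Quantile functions *)

Section quantile.
Context {R : realType} (nu : probability R R).

Let F (r : R) : R := fine (nu `]-oo, r]%classic).

Let X : R -> R := idfun.
#[local] HB.instance Definition _ := isMeasurableFun.Build _ _ R R X (@measurable_id _ _ setT).

Let FE r : (F r)%:E = nu `]-oo, r]%classic.
Proof. by rewrite fineK // fin_num_measure. Qed.

Let cdfE r : cdf (X : {RV nu >-> R}) r = (F r)%:E.
Proof. by rewrite FE /cdf /distribution /pushforward preimage_id. Qed.

Let F_nd : nondecreasing F.
Proof.
move=> r s rs; rewrite -lee_fin -!cdfE; exact: cdf_nondecreasing.
Qed.

Let F01 r : 0 <= F r <= 1.
Proof. by rewrite -!lee_fin FE measure_ge0 probability_le1. Qed.

(** The value outside ]0, 1[, where the set of levels may be empty or unbounded below,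
is arbitrary: these points form a null set. *)
Definition quantile (u : R) : R := if 0 < u < 1 then inf [set r | u <= F r] else 0.

(** The Galois connection between the quantile and distribution functions: right
continuity of F makes the infimum attained. *)
Lemma quantile_le u r : 0 < u < 1 -> (quantile u <= r) = (u <= F r).
Proof.
move=> u01; rewrite /quantile u01; have /andP[u0 u1] := u01.
have Foo : F x @[x --> -oo%R] --> (0 : R).
  exact: (fine_cvg (cvg_cdfNy0 (X : {RV nu >-> R}))).
have Fpo : F x @[x --> +oo%R] --> (1 : R).
  exact: (fine_cvg (cvg_cdfy1 (X : {RV nu >-> R}))).
have Fr : F x @[x --> r^'+] --> F r.
  have := @cdf_right_continuous _ _ _ nu (X : {RV nu >-> R}) r.
  by rewrite cdfE; exact: fine_cvg.
have lb : has_lbound [set r | u <= F r].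
  have [M [_ hM]] : \forall x \near -oo%R, F x < u by exact: (cvgr_lt _ Foo).
  by exists M => s /= us; rewrite leNgt; apply/negP => /hM; rewrite ltNge us.
have ne : [set r | u <= F r] !=set0.
  have [M [_ hM]] : \forall x \near +oo%R, u < F x by exact: (cvgr_gt _ Fpo).
  by exists (M + 1) => /=; apply/ltW/hM; rewrite ltrDl.
apply/idP/idP => [infr|uF]; last exact: ge_inf.
rewrite leNgt; apply/negP => Fu.
have Fs : \forall s \near r^'+, F s < u by exact: (cvgr_lt _ Fr).
have [s [rs su]] := @filter_ex _ _ _ _ (filterI (nbhs_right_gt r) Fs).
have [t ut ts] := inf_lt ne (le_lt_trans infr rs).
by have := le_lt_trans (le_trans ut (F_nd (ltW ts))) su; rewrite ltxx.
Qed.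

Lemma measurable_quantile : measurable_fun setT quantile.
Proof.
apply: (measurability _ (RGenOInfty.measurableE R)) => // _ [_ [r ->] <-].
rewrite setTI.
have -> : quantile @^-1` `]r, +oo[ =
    (`]0, 1[ `&` `]F r, +oo[) `|` (~` `]0, 1[ `&` (if r < 0 then setT else set0)).
  apply/seteqP; split => u /=; rewrite !in_itv /= !andbT.
    case: (boolP (0 < u < 1)) => u01; first by rewrite !ltNge quantile_le //; left.
    by rewrite /quantile (negbTE u01) => ->; right.
  move=> [[u01]|[/negP u01]]; first by rewrite !ltNge quantile_le.
  by rewrite /quantile (negbTE u01); case: ifP.
apply: measurableU; first by apply: measurableI; exact: measurable_itv.
apply: measurableI; first by apply: measurableC; exact: measurable_itv.
by case: ifP.
Qed.

HB.instance Definition _ := isMeasurableFun.Build _ _ R R quantile measurable_quantile.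

Lemma quantile_law (B : set R) : measurable B -> unit_law (quantile @^-1` B) = nu B.
Proof.
have m01 : measurable (`]0, 1[%classic : set R) by exact: measurable_itv.
have full (D : set R) : measurable D -> unit_law (D `&` `]0, 1[%classic) = unit_law D.
  move=> mD.
  apply: (measure_setI_full (P := unit_law : probability R R) mD m01).
  rewrite /= /unit_law (_ : _ `&` _ = `]0, 1[%classic).
    by rewrite lebesgue_measure_itv /= lte_fin ltr01 oppr0 adde0.
  apply/seteqP; split => x /=; rewrite !in_itv /=; first by case.
  by move=> /andP[x0 ->]; rewrite x0 (ltW x0).
have ray (r : R) : unit_law (quantile @^-1` `]-oo, r]%classic) = nu `]-oo, r]%classic.
  have mQ : measurable (quantile @^-1` `]-oo, r]%classic).
    by apply: (measurable_preimage measurable_quantile); exact: measurable_itv.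
  rewrite -FE -unit_law_ray // -(full _ mQ) -[RHS]full; last exact: measurable_itv.
  congr unit_law; apply/seteqP; split => u /= [h u01]; split => //; move: h u01;
    by rewrite !in_itv /= => h u01; rewrite ?quantile_le // in h *; rewrite -quantile_le.
move=> mB.
apply: (measure_unique (RGenOInfty.G (R := R)) (fun n => `]- (n%:R), +oo[%classic)
  _ _ _ _ (distribution unit_law quantile) nu) => //.
- exact: RGenOInfty.measurableE.
- move=> _ _ [x ->] [y ->]; exists (Num.max x y); apply/seteqP; split => z /=.
    by rewrite !in_itv /= !andbT gt_max => -[-> ->].
  by rewrite !in_itv /= !andbT gt_max => /andP[].
- by move=> n; exists (- n%:R).
- apply/seteqP; split => // x _; exists (Num.bound (`|x|)) => //=.
  rewrite in_itv /= andbT ltrNl; apply: le_lt_trans (archi_boundP (normr_ge0 x)).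
  by rewrite -normrN ler_norm.
- move=> _ [x ->].
  have -> : `]x, +oo[%classic = ~` `]-oo, x]%classic :> set R.
    by apply/seteqP; split => y /=; rewrite !in_itv /= andbT ltNge => /negP.
  have mx : measurable (`]-oo, x]%classic : set R) by exact: measurable_itv.
  apply: etrans (probability_setC (distribution unit_law quantile : probability R R) mx) _.
  apply: etrans _ (esym (probability_setC nu mx)).
  congr (1 - _)%E; exact: ray.
- by move=> k; rewrite (le_lt_trans (probability_le1 _ _)) ?ltry //; exact: measurable_itv.
Qed.

End quantile.

(** * Existence of i.i.d. sequences *)

Section existence.
Context {R : realType} {d : measure_display} {A : measurableType d}.
Hypothesis hA : borel_space R A.
Variable rho : probability (A * R)%type R.
Hypothesis rho_unif : unif_second_marginal rho.

Local Notation bits := (seq_space (fun _ : nat => bool)).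

(** A Borel space embeds in [0, 1], and a pair of points of [0, 1] is coded by
interleaving their binary digits and reading the result in base 3. *)
Lemma unit_interval_coding : exists (e : A * R -> R) (h : R -> A * R),
  [/\ measurable_fun setT e, measurable_fun setT h &
      forall x, 0 <= x.2 <= 1 -> h (e x) = x].
Proof.
have [E [f [g [mE E01 fg gf [mf mg]]]]] := hA.
have q2 : 1 < 2 :> R by rewrite ltr1n.
have q3 : 1 < 3 :> R by rewrite ltr1n.
pose g' x := if `[< E x >] then g x else point.
have mg' : measurable_fun setT g'.
  move=> _ B mB; rewrite setTI.
  have -> : g' @^-1` B = (E `&` g @^-1` B) `|`
      (~` E `&` (if `[< B point >] then setT else set0)).
    apply/seteqP; split => x; rewrite /preimage /g' /=.
      by case: asboolP => Ex Bx; [left|right; rewrite asboolT].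
    by move=> [[Ex Bx]|[Ex]]; case: asboolP => //; case: asboolP.
  apply: measurableU; first exact: mg.
  by apply: measurableI; [exact: measurableC|case: ifP].
pose e (x : A * R) : R := value 3 (interleave (digits (2 : R) (f x.1), digits (2 : R) x.2)).
pose h (y : R) : A * R := (g' (value 2 (evens (digits 3 y))), value 2 (odds (digits 3 y))).
exists e, h; split.
- apply: (measurableT_comp (measurable_value q3)).
  apply: (measurableT_comp measurable_interleave).
  apply: measurable_fun_pair; apply: (measurableT_comp (measurable_digits 2)) => //.
  exact: (measurableT_comp mf).
- apply: measurable_fun_pair.
    apply: (measurableT_comp mg'); apply: (measurableT_comp (measurable_value q2)).
    exact: (measurableT_comp measurable_evens (measurable_digits 3)).
  apply: (measurableT_comp (measurable_value q2)).
  exact: (measurableT_comp measurable_odds (measurable_digits 3)).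
- move=> [a u] /= u01; rewrite /h /e digits3_value evens_interleave odds_interleave /=.
  have [Ea ga] := fg a; have := E01 _ Ea; rewrite /= in_itv /= => fa01.
  by rewrite !value_digits2 // /g' asboolT // ga.
Qed.

(** The quantile function of the coded law, followed by decoding. Decoding inverts the
coding on A x [0, 1] only, which has full mass. *)
Lemma sampler : exists h : bits -> A * R, measurable_fun setT h /\
  forall B, measurable B -> bit_law (h @^-1` B) = rho B.
Proof.
have [e [h [me mh eK]]] := unit_interval_coding.
have q2 : 1 < 2 :> R by rewrite ltr1n.
pose e' : {mfun (A * R)%type >-> R} := mfun_Sub (mem_set me).
pose nu : probability R R := distribution rho e'.
have mhq : measurable_fun setT (h \o quantile nu).
  exact: (measurableT_comp mh (measurable_quantile nu)).
exists (h \o quantile nu \o value 2); split.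
  exact: (measurableT_comp mhq (measurable_value q2)).
move=> B mB.
rewrite comp_preimage bit_law_value; last exact: measurable_preimage mhq mB.
rewrite comp_preimage quantile_law; last exact: measurable_preimage mh mB.
have mU : measurable ([set: A] `*` (`[0, 1]%classic : set R)).
  by apply: measurableX => //; exact: measurable_itv.
have U1 : rho ([set: A] `*` (`[0, 1]%classic : set R)) = 1%E.
  by apply: rho_unif; rewrite ler01 lexx.
have mN : measurable (e' @^-1` (h @^-1` B)).
  by apply: (measurable_preimage me); exact: measurable_preimage mh mB.
rewrite /nu /distribution /pushforward.
apply: etrans (esym (measure_setI_full mN mU U1)) _.
apply: etrans _ (measure_setI_full mB mU U1).
congr (rho _); apply/seteqP; split => x /= [Bx [_ x01]]; split => //;
  by move: Bx x01; rewrite in_itv /preimage /= => Bx x01; rewrite eK // in Bx *.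
Qed.

Lemma exists_iid : exists Z : nat -> {RV (bit_law : probability bits R) >-> (A * R)%type},
  iid Z rho.
Proof.
have [h [mh hrho]] := sampler.
(* The even bits are used for the first sample, the odd ones are kept for the
   following samples. *)
pose Z n (c : bits) := h (evens (iter n odds c)).
have mhe : measurable_fun setT (h \o evens).
  exact: (measurableT_comp mh measurable_evens).
have mZ n : measurable_fun setT (Z n).
  apply: (measurableT_comp mhe); elim: n => [|n IH]; first exact: measurable_id.
  exact: (measurableT_comp measurable_odds).
exists (fun n => mfun_Sub (mem_set (mZ n))); apply/iid_lawP.
apply: (@iid_law_split _ _ _ _ _ bit_law rho (h \o evens) odds mhe measurable_odds).
move=> B C mB mC; rewrite comp_preimage bit_law_evens_odds //; last first.
  exact: measurable_preimage mh mB.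
by rewrite hrho.
Qed.

End existence.

(** * Stable sorting and ranks *)

Lemma card_ord_lt n k : (k <= n)%N -> #|[pred j : 'I_n | (j < k)%N]| = k.
Proof.
move=> kn; rewrite -sum1_card (eq_bigl (fun j : 'I_n => (j < k)%N)) //.
by rewrite (big_ord_narrow kn) sum1_card card_ord.
Qed.

Lemma card_perm_preim n (s : 'S_n) (q : pred 'I_n) :
  #|[pred k | q (s k)]| = #|[pred k | q k]|.
Proof.
rewrite -!sum1_card [RHS](reindex_inj (@perm_inj _ s)).
by apply: eq_bigl => k; rewrite !inE.
Qed.

Lemma down_closed_ord n (p : pred 'I_n) :
  (forall i j : 'I_n, (i <= j)%N -> p j -> p i) ->
  forall i, p i = (i < #|[pred k | p k]|)%N.
Proof.
move=> pd i; apply/idP/idP => [p_i|].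
  rewrite -(@card_ord_lt n i.+1) //.
  apply: subset_leq_card; apply/fintype.subsetP => j; rewrite !inE ltnS => ji.
  exact: pd p_i.
apply: contraTT => npi; rewrite -leqNgt -(card_ord_lt (ltnW (ltn_ord i))).
apply: subset_leq_card; apply/fintype.subsetP => j; rewrite !inE => pj.
by rewrite ltnNge; apply: contra npi => ij; exact: pd ij pj.
Qed.

Section stable_sorting.
Context {R : realType}.

Lemma stable_le_total n (x : n.-tuple R) : total (stable_le x).
Proof.
move=> i j; rewrite /stable_le; case: ltgtP => //= _.
exact: leq_total.
Qed.

Lemma stable_le_trans n (x : n.-tuple R) : transitive (stable_le x).
Proof.
move=> j i k; rewrite /stable_le.
move=> /orP[ij|/andP[/eqP-> ij]] /orP[jk|/andP[/eqP<- jk]].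
- by rewrite (lt_trans ij jk).
- by rewrite ij.
- by rewrite jk.
- by rewrite eqxx (leq_trans ij jk) orbT.
Qed.

Lemma stable_le_anti n (x : n.-tuple R) : antisymmetric (stable_le x).
Proof.
move=> i j; rewrite /stable_le; case: ltgtP => //= _ h.
by apply/val_inj/eqP; rewrite eqn_leq.
Qed.

Lemma stable_le_value n (x : n.-tuple R) i j :
  stable_le x i j -> tnth x i <= tnth x j.
Proof. by case/orP => [/ltW//|/andP[/eqP->]]. Qed.

Lemma ps_sorted n (x : n.-tuple R) (i j : 'I_n) :
  (i <= j)%N -> stable_le x (ps x i) (ps x j).
Proof.
move=> ij; rewrite !permE /ps_fun !(tnth_nth i).
apply: (sorted_leq_nth (@stable_le_trans _ x)) => //.
- by move=> k; rewrite /stable_le eqxx leqnn orbT.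
- by apply: sort_sorted; exact: stable_le_total.
- by rewrite inE size_tuple.
- by rewrite inE size_tuple.
Qed.

(** The stable order is total and antisymmetric, so the sorted list is unique. *)
Lemma ps_unique n (x : n.-tuple R) (s : 'S_n) :
  (forall i j : 'I_n, (i < j)%N -> stable_le x (s i) (s j)) -> ps x = s.
Proof.
move=> hs; apply/permP => i; rewrite permE /ps_fun.
suff -> : sort_tuple (stable_le x) (ord_tuple n) = [tuple s i | i < n].
  by rewrite tnth_mktuple.
apply/val_inj => /=; apply: (@sorted_eq _ (stable_le x)).
- exact: stable_le_trans.
- exact: stable_le_anti.
- by apply: sort_sorted; exact: stable_le_total.
- rewrite sorted_map.
  have : sorted ltn (map val (enum 'I_n)) by rewrite val_enum_ord iota_ltn_sorted.
  rewrite sorted_map; apply: sub_sorted => a b; exact: hs.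
- rewrite perm_sort; apply: uniq_perm.
  + exact: enum_uniq.
  + by rewrite map_inj_uniq ?enum_uniq //; exact: perm_inj.
  + move=> k; rewrite mem_enum; apply/esym/mapP; exists (s^-1 k)%g.
      by rewrite mem_enum.
    by rewrite permKV.
Qed.

(** Stable sorting is insertion sort: with the last index removed the others are
sorted by themselves, and the last index, which comes after all values that are at
most its own, goes to the place given by the number of these. *)
Lemma ps_last n (x : n.+1.-tuple R) :
  ps x = lift_perm (last_rank x) ord_max
    (ps [tuple tnth x (lift ord_max i) | i < n]).
Proof.
set x' := [tuple _ | i < n].
have x'E i : tnth x' i = tnth x (lift ord_max i) by rewrite tnth_mktuple.
set t := tnth x ord_max.
(* Along the sorted order the values at most t form an initial segment, whose
   length is the last rank. *)
pose p k := tnth x' (ps x' k) <= t.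
have pdown (i j : 'I_n) : (i <= j)%N -> p j -> p i.
  by move=> /(ps_sorted x') /stable_le_value ij; exact: le_trans.
have lrE : last_rank x = #|[pred k | p k]| :> nat.
  rewrite (card_perm_preim (ps x') (fun k => tnth x' k <= t)) /last_rank.
  have -> : #|[pred k | tnth x k <= tnth x ord_max]| =
            #|[pred k | tnth x' k <= t]|.+1.
    rewrite -!sum1_card big_mkcond big_ord_recr /= inE lexx addn1; congr _.+1.
    rewrite [RHS]big_mkcond; apply: eq_bigr => k _; rewrite !inE x'E.
    congr (if tnth x _ <= _ then _ else _); apply/val_inj => /=.
    by rewrite /bump leqNgt ltn_ord.
  by rewrite inordK //= ltnS -[X in (_ <= X)%N]card_ord max_card.
apply: ps_unique => i j.
case: (unliftP (last_rank x) i) => [i0|] ->; case: (unliftP (last_rank x) j) => [j0|] -> ij.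
- rewrite !lift_perm_lift.
  have /(ps_sorted x') : (i0 <= j0)%N.
    by apply: ltnW; move: ij; rewrite /= /bump; lia.
  rewrite /stable_le !x'E => /orP[->//|/andP[-> h]] /=.
  by rewrite leq_bump2 h orbT.
- rewrite lift_perm_lift lift_perm_id.
  have : p i0 by rewrite (down_closed_ord pdown) -lrE; move: ij; rewrite /= /bump; lia.
  rewrite /p x'E /stable_le le_eqVlt -/t orbC => /orP[->//|->].
  by rewrite leq_ord orbT.
- rewrite lift_perm_lift lift_perm_id.
  have : ~~ p j0 by rewrite (down_closed_ord pdown) -lrE; move: ij; rewrite /= /bump; lia.
  by rewrite /p x'E /stable_le -/t -ltNge => ->.
- by rewrite ltnn in ij.
Qed.

(** Without ties the indices do not matter for sorting; with ties the identity fails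
since stability refers to the indices. *)
Lemma ps_perm n (x : n.-tuple R) (s : 'S_n) : injective (tnth x) ->
  ps [tuple tnth x (s i) | i < n] = (ps x * s^-1)%g.
Proof.
move=> xinj; apply: ps_unique => i j ij; rewrite !permM /stable_le !tnth_mktuple !permKV.
have := ps_sorted x (ltnW ij); rewrite /stable_le => /orP[->//|/andP[/eqP/xinj/perm_inj ijE _]].
by rewrite ijE ltnn in ij.
Qed.

Lemma ios_perm (T : Type) n (y : n.-tuple T) (x : n.-tuple R) (s : 'S_n) :
  injective (tnth x) ->
  ios [tuple tnth y (s i) | i < n] [tuple tnth x (s i) | i < n] = ios y x.
Proof.
move=> xinj; apply: eq_from_tnth => i.
by rewrite !tnth_mktuple ps_perm // permM permKV.
Qed.

End stable_sorting.

Definition first_terms (T : Type) (f : nat -> T) n : n.+1.-tuple T :=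
  [tuple f j | j < n.+1].

(** The place of each of the first n + 1 items in the word of that length. A new item
takes the place given by its code and shifts the items after it, which is what
[lift] does. *)
Fixpoint insertion_perm (e : forall n, 'I_n.+1) n : 'S_n.+1 :=
  if n is m.+1 then lift_perm ord_max (e m.+1) (insertion_perm e m) else 1%g.

Lemma insertion_perm_last e n : insertion_perm e n ord_max = e n.
Proof.
case: n => [|n] /=; last by rewrite lift_perm_id.
by rewrite perm1 [LHS]ord1 [RHS]ord1.
Qed.

Lemma lift_perm_last_inj n (i j : 'I_n.+1) (s t : 'S_n) :
  lift_perm ord_max i s = lift_perm ord_max j t -> i = j /\ s = t.
Proof.
move=> h; have ij : i = j by rewrite -(lift_perm_id ord_max i s) h lift_perm_id.
split=> //; apply/permP => k; apply: (@lift_inj _ i).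
by rewrite -(lift_perm_lift ord_max) h lift_perm_lift ij.
Qed.

Lemma lift_perm_last_surj n (s : 'S_n.+1) :
  exists t : 'S_n, s = lift_perm ord_max (s ord_max) t.
Proof.
pose f (k : 'I_n) : 'I_n := odflt k (unlift (s ord_max) (s (lift ord_max k))).
have fE k : lift (s ord_max) (f k) = s (lift ord_max k).
  rewrite /f; case: unliftP => [j //|/perm_inj/eqP].
  by rewrite eq_sym (negbTE (neq_lift _ _)).
have finj : injective f.
  move=> a b ab; apply: (@lift_inj _ ord_max); apply: (@perm_inj _ s).
  by rewrite -!fE ab.
exists (perm finj); apply/permP => k; case: (unliftP ord_max k) => [j|] ->.
  by rewrite lift_perm_lift permE fE.
by rewrite lift_perm_id.
Qed.

Section ranks.
Context {R : realType} (u : nat -> R).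

(** The permutation [ps] sends places to items; the rank is its inverse, which sends
items to places. *)
Definition rank n : 'S_n.+1 := ((ps (first_terms u n))^-1)%g.

Lemma rankS n : rank n.+1 =
  lift_perm ord_max (last_rank (first_terms u n.+1)) (rank n).
Proof.
rewrite /rank ps_last lift_permV; congr (lift_perm _ _ (ps _)^-1).
apply: eq_from_tnth => i; rewrite !tnth_mktuple /=.
by rewrite /bump leqNgt ltn_ord.
Qed.

Lemma insertion_perm_rank n :
  insertion_perm (fun n => last_rank (first_terms u n)) n = rank n.
Proof.
elim: n => [|n IH]; last by rewrite rankS /= IH.
by apply/permP => i; rewrite [LHS]ord1 [RHS]ord1.
Qed.

Lemma rank_last n : rank n ord_max = last_rank (first_terms u n).
Proof. by rewrite -insertion_perm_rank insertion_perm_last. Qed.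

Lemma rank_stable_le n (i j : 'I_n.+1) :
  (rank n i <= rank n j)%N -> stable_le (first_terms u n) i j.
Proof. by move=> /(ps_sorted (first_terms u n)); rewrite !permKV. Qed.

Lemma card_rank_lt n (i : 'I_n.+1) :
  #|[pred k | (rank n k < rank n i)%N]| = rank n i.
Proof.
by rewrite (card_perm_preim (rank n) (fun k => (k < rank n i)%N)) card_ord_lt // ltnW.
Qed.

(** Together with [rank_lt] this encloses the rank between the numbers of smaller
values and of values that are at most as large, whatever the ties. *)
Lemma rank_ge n (i : 'I_n.+1) : 
  (#|[pred k : 'I_n.+1 | (u k < u i)%R]| <= rank n i)%N.
Proof.
rewrite -[X in (_ <= X)%N]card_rank_lt; apply: subset_leq_card.
apply/fintype.subsetP => k; rewrite !inE; apply: contraTT; rewrite -leqNgt => h.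
by have /stable_le_value := rank_stable_le h; rewrite !tnth_mktuple leNgt.
Qed.

Lemma rank_lt n (i : 'I_n.+1) :
  (rank n i < #|[pred k : 'I_n.+1 | (u k <= u i)%R]|)%N.
Proof.
have -> : (rank n i).+1 = #|[pred k | (rank n k < (rank n i).+1)%N]|.
  by rewrite (card_perm_preim (rank n) (fun k => (k < (rank n i).+1)%N)) card_ord_lt.
apply: subset_leq_card; apply/fintype.subsetP => k; rewrite !inE ltnS => h.
by have /stable_le_value := rank_stable_le h; rewrite !tnth_mktuple.
Qed.

Section words_of_ranks.
Context {T : Type} (y : nat -> T).

Lemma ios_rank n (i : 'I_n.+1) :
  tnth (ios (first_terms y n) (first_terms u n)) (rank n i) = y i.
Proof. by rewrite !tnth_mktuple permKV. Qed.

Lemma ios_unique n (w : n.+1.-tuple T) :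
  (forall i : 'I_n.+1, tnth w (rank n i) = y i) ->
  w = ios (first_terms y n) (first_terms u n).
Proof.
move=> h; apply: eq_from_tnth => i.
by rewrite -[i](permKV (rank n)) h ios_rank.
Qed.

(** In terms of ranks both words put each item at the same place up to the shift made
by the last insertion, and erasure undoes that shift. *)
Lemma erase_ios n : 
  erase (ios (first_terms y n.+1) (first_terms u n.+1)) (last_rank (first_terms u n.+1)) =
  ios (first_terms y n) (first_terms u n).
Proof.
apply: ios_unique => i; rewrite tnth_mktuple -(lift_perm_lift ord_max) -rankS ios_rank.
by rewrite /= /bump leqNgt ltn_ord.
Qed.

End words_of_ranks.
End ranks.

(** * Sorting an exchangeable sequence *)

Section marked_sequences.
Context {R : realType} {d : measure_display} {A : measurableType d}.
Implicit Types x : nat -> A * R.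

Definition marks x n : R := (x n).2.
Definition letters x n : A := (x n).1.

Definition sorted_word n x : n.+1.-tuple A :=
  ios (first_terms (letters x) n) (first_terms (marks x) n).

(** The process (W, eta) of the statement, as a function of the sequence of pairs. *)
Definition sorted_path x : gewp_space A :=
  fun n => (sorted_word n x, last_rank (first_terms (marks x) n)).

Definition no_ties : set (nat -> A * R) := [set x | injective (marks x)].

Local Notation S := (seq_space (fun _ : nat => A * R : measurableType _)%type).

Lemma measurable_marks n : measurable_fun setT (fun x : S => marks x n).
Proof. exact: (measurableT_comp measurable_snd (measurable_coordinate n)). Qed.

Lemma measurable_letters n : measurable_fun setT (fun x : S => letters x n).
Proof. exact: (measurableT_comp measurable_fst (measurable_coordinate n)). Qed.

Lemma measurable_first_terms d1 d2 (T : measurableType d1) (Om : measurableType d2)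
    (f : Om -> nat -> T) n :
  (forall k, measurable_fun setT (fun w => f w k)) ->
  measurable_fun setT (fun w => first_terms (f w) n).
Proof.
move=> mf; apply/measurable_fun_tnthP => i.
have -> : (fun t => tnth t i) \o (fun w => first_terms (f w) n) = (fun w => f w i).
  by apply/funext => w /=; rewrite tnth_mktuple.
exact: mf.
Qed.

Lemma measurable_sorted_word n : measurable_fun setT (fun x : S => sorted_word n x).
Proof.
apply: measurable_ios; apply: measurable_first_terms => k.
  exact: measurable_letters.
exact: measurable_marks.
Qed.

Lemma measurable_sorted_last_rank n :
  measurable_fun setT (fun x : S => last_rank (first_terms (marks x) n)).
Proof.
by apply: measurable_last_rank; apply: measurable_first_terms => k; exact: measurable_marks.
Qed.

Lemma measurable_rank n (k : 'I_n.+1) (B : set 'I_n.+1) :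
  measurable ((fun x : S => rank (marks x) n k) @^-1` B).
Proof.
apply: (measurable_preimage_dep (g := fun x : S => comparisons (first_terms (marks x) n))).
  move=> c; apply: measurable_comparisons; apply: measurable_first_terms => j.
  exact: measurable_marks.
by move=> x x' /comparisons_ps h; rewrite /rank h.
Qed.

Lemma measurable_sorted_path : measurable_fun setT (sorted_path : S -> gewp_space A).
Proof.
apply: (@measurable_seq _ (fun n => n.+1.-tuple A * 'I_n.+1)%type) => n.
apply: measurable_fun_pair; first exact: measurable_sorted_word.
exact: measurable_sorted_last_rank.
Qed.

Lemma measurable_no_ties : measurable (no_ties : set S).
Proof.
have -> : no_ties = \bigcap_i \bigcap_(j in [set j | j != i])
    ~` [set x : S | marks x i = marks x j].
  apply/seteqP; split => x /=.
    by move=> xinj i _ j /= ji /= xij; move: ji; rewrite (xinj _ _ xij) eqxx.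
  move=> h i j xij; apply/eqP; apply: contrapT => /negP ij.
  by apply: (h i I j) => //=; rewrite eq_sym.
apply: bigcap_measurableType => i _; apply: bigcap_measurableType => j _.
by apply: measurableC; apply: measurable_set_eq; exact: measurable_marks.
Qed.

Lemma no_ties_reindex x (s : nat -> nat) : injective s -> no_ties x ->
  no_ties (fun n => x (s n)).
Proof. by move=> sinj xinj i j /xinj/sinj. Qed.

Lemma first_terms_swapn (T : Type) (f : nat -> T) i j n (ni : (i <= n)%N)
    (nj : (j <= n)%N) :
  first_terms (fun k => f (swapn i j k)) n =
  [tuple tnth (first_terms f n) (tperm (inord i) (inord j) k) | k < n.+1].
Proof.
apply: eq_from_tnth => k; rewrite !tnth_mktuple; congr f.
rewrite /swapn; case: tpermP => [->|->|/eqP ki /eqP kj]; rewrite ?inordK // ?eqxx //.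
  by case: eqP.
have -> : (k == i :> nat) = false.
  by apply: contraNF ki => /eqP <-; rewrite inord_val.
have -> // : (k == j :> nat) = false.
by apply: contraNF kj => /eqP <-; rewrite inord_val.
Qed.

Lemma no_ties_first_terms x n : no_ties x -> injective (tnth (first_terms (marks x) n)).
Proof. by move=> xinj i j; rewrite !tnth_mktuple => /xinj /val_inj. Qed.

Lemma sorted_word_swapn x i j n : no_ties x -> (i <= n)%N -> (j <= n)%N ->
  sorted_word n (fun k => x (swapn i j k)) = sorted_word n x.
Proof.
move=> xinj ni nj; rewrite /sorted_word.
rewrite (first_terms_swapn (letters x) ni nj) (first_terms_swapn (marks x) ni nj).
by rewrite ios_perm //; exact: no_ties_first_terms.
Qed.

Lemma rank_swapn x i j n k : no_ties x -> (i <= n)%N -> (j <= n)%N ->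
  rank (fun k => marks x (swapn i j k)) n k =
  rank (marks x) n (tperm (inord i) (inord j) k).
Proof.
move=> xinj ni nj; rewrite /rank (first_terms_swapn (marks x) ni nj) ps_perm.
  by rewrite invMg invgK permM.
exact: no_ties_first_terms.
Qed.

End marked_sequences.

Section exchangeable_gewp.
Context {R : realType} {d d' : measure_display} {A : measurableType d}.
Context {Om : measurableType d'} {P : probability Om R}.
Variable Z : nat -> {RV P >-> (A * R)%type}.
Hypothesis exZ : exchangeable P Z.
Hypothesis distinct : P (path Z @^-1` no_ties) = 1%E.

Local Notation S := (seq_space (fun _ : nat => A * R : measurableType _)%type).

Let mZ : measurable_fun setT (path Z).
Proof. by apply: measurable_path => n; exact: measurable_funP. Qed.

(** Invariance is asked for in the absence of ties only: with ties, stable sorting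
depends on the order of the items. *)
Let sym_event n : set (set Om) := [set C | exists C' : set S, [/\ measurable C', 
  C = path Z @^-1` C' &
  forall k x, (k <= n)%N -> no_ties x -> C' (fun l => x (swapn k n l)) <-> C' x]].

(** A word W_k with k at least n is sorted from a set of items that contains items
0, ..., n, and so does not depend on their order. A place eta_(k + 1) is the rank
of an item later than n, which depends on the set of earlier items only. *)
Lemma tail_sigma_symmetric n : tail_sigma (ios_W Z) (ios_Eta Z) n `<=` sym_event n.
Proof.
apply: smallest_sub.
  split.
  - by exists set0; split; rewrite ?preimage_set0.
  - move=> C [C' [mC' -> sC']]; exists (~` C'); split.
    + exact: measurableC.
    + by rewrite setTD preimage_setC.
    + by move=> k x kn xD /=; rewrite (sC' k x kn xD).
  - move=> F /choice[F' F'E]; exists (\bigcup_i F' i); split.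
    + by apply: bigcup_measurable => i _; case: (F'E i).
    + by rewrite preimage_bigcup; apply: eq_bigcupr => i _; case: (F'E i).
    + by move=> k x kn xD; split => -[i _ h]; exists i => //;
        have [_ _ s] := F'E i; apply/(s k x kn xD).
move=> C [k /= nk [[B mB <-]|[B mB <-]]]; rewrite setTI.
- exists ((fun x : S => sorted_word k x) @^-1` B); split => //.
    exact: measurable_preimage (@measurable_sorted_word _ _ _ k) mB.
  move=> i x ni xD; rewrite /preimage /= (sorted_word_swapn xD) //.
  exact: leq_trans ni nk.
- exists ((fun x : S => last_rank (first_terms (marks x) k.+1)) @^-1` B); split => //.
    exact: measurable_preimage (@measurable_sorted_last_rank _ _ _ k.+1) mB.
  move=> i x ni xD; rewrite /preimage /= -!rank_last (rank_swapn _ xD).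
  + rewrite tpermD //.
      by apply/eqP => /(congr1 val) /=; rewrite inordK; lia.
    by apply/eqP => /(congr1 val) /=; rewrite inordK; lia.
  + lia.
  + lia.
Qed.

(** By exchangeability and the symmetry of C, each of the items 0, ..., n is equally
likely to be at place i together with C. As exactly one of them is at place i, these
n + 1 equal probabilities add up to the probability of C. *)
Lemma last_rank_uniform n (i : 'I_n.+1) C :
  tail_sigma (ios_W Z) (ios_Eta Z) n C ->
  P (ios_Eta Z n @^-1` [set i] `&` C) = ((n.+1%:R^-1)%:E * P C)%E.
Proof.
move=> /tail_sigma_symmetric [C' [mC' -> sC']].
pose E k : set S := [set x | no_ties x /\ C' x /\ rank (marks x) n k = i].
have mr k : measurable ((fun x : S => rank (marks x) n k) @^-1` [set i]).
  exact: measurable_rank.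
have mD := @measurable_no_ties R d A.
have mE k : measurable (E k).
  exact: (measurableI _ _ mD (measurableI _ _ mC' (mr k))).
have PE k : P (path Z @^-1` E k) = P (ios_Eta Z n @^-1` [set i] `&` path Z @^-1` C').
  have mG : measurable ((fun x : S => last_rank (first_terms (marks x) n)) @^-1` [set i] `&` C').
    by apply: measurableI => //; exact: measurable_preimage (@measurable_sorted_last_rank _ _ _ n) _.
  set G := (X in measurable X) in mG.
  rewrite -[RHS]/(P (path Z @^-1` G)) -[RHS](@measure_setI_full _ _ _ P _ _ _ _ distinct).
  + rewrite -[RHS]/(P (path Z @^-1` (G `&` no_ties))).
    rewrite -(exZ k n (measurableI _ _ mG mD)).
    congr (P _); apply/seteqP; split=> w /=.
      move=> [xD [xC xr]]; split; last exact: (no_ties_reindex (@swapn_inj k n) xD).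
      split; last by apply/(sC' k _ _ xD) => //; rewrite -ltnS.
      rewrite /= -rank_last (rank_swapn _ xD) ?inord_val //; last by rewrite -ltnS.
      by rewrite -[X in tperm _ _ X]inord_val tpermR.
    move=> [[xr xC] xD'].
    have xD : no_ties (path Z w).
      have := no_ties_reindex (@swapn_inj k n) xD'.
      congr no_ties; apply/funext => l; rewrite /path; congr (Z _ w).
      by rewrite swapnK.
    split=> //; split; first by apply/(sC' k _ _ xD) => //; rewrite -ltnS.
    move: xr; rewrite /= -rank_last (rank_swapn _ xD) ?inord_val //; last by rewrite -ltnS.
    by rewrite -[X in tperm _ _ X]inord_val tpermR.
  + exact: measurable_preimage mG.
  + exact: measurable_preimage mD.
have : (\sum_(k < n.+1) P (path Z @^-1` E k) = P (path Z @^-1` C'))%E.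
  rewrite -[RHS](@measure_setI_full _ _ _ P _ _ _ _ distinct).
  - rewrite (@measure_finite_partition _ _ _ P _ (fun k => path Z @^-1` E k)) //.
    + by move=> k; exact: measurable_preimage (mE k).
    + by move=> a b _ _ [w [[_ [_ ra]] [_ [_ rb]]]]; exact: perm_inj (etrans ra (esym rb)).
    + apply/seteqP; split => w /= [].
        move=> xC xD; exists ((rank (marks (path Z w)) n)^-1 i)%g => //.
        by split=> //; split => //=; rewrite permKV.
      by move=> k _ [xD [xC _]].
  - exact: measurable_preimage mC'.
  - exact: measurable_preimage mD.
under eq_bigr => k _ do rewrite PE.
rewrite -[P (ios_Eta Z n @^-1` _ `&` _)]fineK; last first.
  by rewrite -(PE ord0); apply: fin_num_measure; exact: measurable_preimage (mE _).
rewrite sumEFin sumr_const card_ord => <-.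
by rewrite -EFinM -[fine _ *+ _]mulr_natl mulrA mulVf ?mul1r // pnatr_eq0.
Qed.

Lemma exchangeable_is_gewp : is_gewp (ios_W Z) (ios_Eta Z).
Proof.
move=> n.
have unif i : P (ios_Eta Z n @^-1` [set i]) = ((n.+1%:R^-1)%:E)%E.
  have := @last_rank_uniform n i setT.
  rewrite setIT probability_setT mule1; apply.
  have [s0 sC _] := smallest_sigma_algebra setT (\bigcup_(k in [set k | (n <= k)%N])
    (preimage_set_system setT (ios_W Z k) measurable `|`
     preimage_set_system setT (ios_Eta Z k.+1) measurable)).
  by have := sC _ s0; rewrite setD0.
split => //.
- move=> B C mB tC.
  have mC : measurable C.
    by have /tail_sigma_symmetric[C' [mC' -> _]] := tC; exact: measurable_preimage mC'.
  have meta i : measurable (ios_Eta Z n @^-1` [set i]).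
    exact: (measurable_preimage (measurable_funP _)).
  rewrite (measure_finite_preimage P) // -[X in (P X * _)%E]setIT.
  rewrite (measure_finite_preimage P) // ge0_sume_distrl; last first.
    by move=> i _; case: ifP.
  apply: eq_bigr => i _; case: ifP => _; last by rewrite mul0e.
  by rewrite last_rank_uniform // setIT unif.
- by apply: aeW => w; exact: (esym (erase_ios (marks (path Z w)) (letters (path Z w)) n)).
Qed.

End exchangeable_gewp.

(** * A strong law along the powers of two *)

Section strong_law.
Context {R : realType} {d : measure_display} {Om : measurableType d}.
Variable P : probability Om R.

Lemma integral_sum_indic (I : finType) (F : I -> set Om) :
  (forall i, measurable (F i)) ->
  (\int[P]_w (\sum_(i : I) \1_(F i) w)%:E = \sum_(i : I) P (F i))%E.
Proof.
move=> mF; under eq_integral do rewrite -sumEFin.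
rewrite ge0_integral_sum //.
- by apply: eq_bigr => i _; rewrite integral_indic // setIT.
- by move=> i; apply/measurable_EFinP; exact: measurable_indic.
Qed.

Variables (E : nat -> set Om) (p : R).
Hypotheses (mE : forall k, measurable (E k)) (PE : forall k, P (E k) = p%:E).
Hypothesis PEE : forall k l, k != l -> P (E k `&` E l) = (p * p)%:E.

Definition frequency N w : R := (\sum_(k < N) \1_(E k) w) / N%:R.

Let p01 : 0 <= p <= 1.
Proof. by rewrite -!lee_fin -(PE 0) measure_ge0 probability_le1. Qed.

Let S N w : R := \sum_(k < N) \1_(E k) w.

Let mS N : measurable_fun setT (S N).
Proof. by apply: measurable_sum => k; exact: measurable_indic. Qed.

(** The square is expanded with its negative term moved to the other side, which
leaves integrals of nonnegative functions only. *)
Lemma variance_count N :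
  (\int[P]_w ((S N w - N%:R * p) ^+ 2)%:E = (N%:R * (p * (1 - p)))%:E)%E.
Proof.
have /andP[p0 p1] := p01.
pose g w := (S N w - N%:R * p) ^+ 2.
have mg : measurable_fun setT g.
  by apply: measurable_funX; apply: measurable_funB => //; exact: mS.
have S0 w : 0 <= S N w by apply: sumr_ge0 => k _.
have I1 : (\int[P]_w (g w)%:E + \int[P]_w ((2 * N%:R * p) * S N w)%:E =
  \int[P]_w (\sum_(ij : 'I_N * 'I_N) \1_(E ij.1 `&` E ij.2) w)%:E +
  \int[P]_w ((N%:R * p) ^+ 2)%:E)%E.
  have m1 : measurable_fun setT (fun w => (g w)%:E) by exact/measurable_EFinP.
  have m2 : measurable_fun setT (fun w => ((2 * N%:R * p) * S N w)%:E).
    by apply/measurable_EFinP; apply: measurable_funM => //; exact: mS.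
  have m3 : measurable_fun setT
      (fun w => (\sum_(ij : 'I_N * 'I_N) \1_(E ij.1 `&` E ij.2) w)%:E : \bar R).
    apply/measurable_EFinP; apply: measurable_sum => k.
    by apply: measurable_indic; exact: measurableI.
  have p1' w : setT w -> (0 <= (g w)%:E)%E by rewrite lee_fin sqr_ge0.
  have p2 w : setT w -> (0 <= ((2 * N%:R * p) * S N w)%:E)%E.
    by rewrite lee_fin !mulr_ge0.
  have p3 w : setT w ->
      (0 <= (\sum_(ij : 'I_N * 'I_N) \1_(E ij.1 `&` E ij.2) w)%:E :> \bar R)%E.
    by rewrite lee_fin sumr_ge0.
  have p4 w : @setT Om w -> (0 <= ((N%:R * p) ^+ 2)%:E :> \bar R)%E.
    by rewrite lee_fin sqr_ge0.
  rewrite -(ge0_integralD P measurableT p1' m1 p2 m2).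
  rewrite -(ge0_integralD P measurableT p3 m3 p4) //.
  apply: eq_integral => w _; rewrite -!EFinD; congr _%:E.
  have -> : \sum_(ij : 'I_N * 'I_N) \1_(E ij.1 `&` E ij.2) w = S N w * S N w.
    rewrite /S big_distrlr /= pair_bigA /=; apply: eq_bigr => ij _.
    by rewrite indicI.
  by rewrite /g; ring.
move: I1.
rewrite integral_sum_indic; last by move=> k; exact: measurableI.
have Icst (r : R) : (\int[P]_w r%:E = r%:E)%E.
  by rewrite integral_cst // -[RHS]mule1; congr (_ * _)%E; exact: probability_setT.
rewrite Icst.
under [X in (_ + X)%E = _]eq_integral do rewrite EFinM.
rewrite ge0_integralZl_EFin //; last 3 first.
- by move=> w _; rewrite lee_fin.
- exact/measurable_EFinP/mS.
- by rewrite !mulr_ge0.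
rewrite (integral_sum_indic (F := fun k : 'I_N => E k)) //.
under [X in (_ * X)%E]eq_bigr do rewrite PE.
rewrite -(pair_bigA _ (fun i j : 'I_N => P (E i `&` E j))) /=.
have -> : (\sum_(i < N) \sum_(j < N) P (E i `&` E j) =
   (\sum_(i < N) (p + (N%:R - 1) * (p * p)))%:E)%E.
  rewrite -sumEFin; apply: eq_bigr => i _; rewrite (bigD1 i) //= setIid PE EFinD.
  congr (_ + _)%E; rewrite (eq_bigr (fun=> (p * p)%:E)); last first.
    by move=> j ji; rewrite PEE // eq_sym.
  rewrite sumEFin sumr_const cardC1 card_ord; congr _%:E.
  by case: N i {mg S0 g} => [[]//|n] i; rewrite /= -natr1 addrK mulr_natl.
rewrite !sumEFin !sumr_const card_ord -EFinM.
rewrite -[(\int[P]_w ((S N w - N%:R * p) ^+ 2)%:E)%E]/(\int[P]_w (g w)%:E)%E.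
case: (\int[P]_w (g w)%:E)%E => [x||] //= [h]; congr _%:E.
by apply: (addIr (2 * N%:R * p * (p *+ N))); rewrite h; ring.
Qed.

(** The variance of a frequency over N terms is at most 1 / N. Along N = 2^m this is
summable, so that the sum of the squared deviations is integrable, hence almost
surely finite. *)
Lemma frequency_cvg :
  {ae P, forall w, frequency (2 ^ m) w @[m --> \oo] --> p}.
Proof.
have /andP[p0 p1] := p01.
pose f m w : R := (frequency (2 ^ m) w - p) ^+ 2.
have mf m : measurable_fun setT (fun w => (f m w)%:E).
  apply/measurable_EFinP; apply: measurable_funX; apply: measurable_funB => //.
  by apply: measurable_funM => //; exact: mS.
have If m : (\int[P]_w (f m w)%:E <= (2 / (2 ^ m.+1)%:R)%:E)%E.
  have fE w : (f m w)%:E = (((2 ^ m)%:R ^- 2)%:E * ((S (2 ^ m) w - (2 ^ m)%:R * p) ^+ 2)%:E)%E.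
    rewrite -EFinM /f /frequency -/(S _ w); congr _%:E.
    by field; rewrite natrX expf_neq0.
  under eq_integral do rewrite fE.
  rewrite ge0_integralZl_EFin //; first last.
  - apply/measurable_EFinP; apply: measurable_funX.
    exact: (measurable_funB (mS _) (measurable_cst _)).
  - by move=> w _; rewrite lee_fin sqr_ge0.
  rewrite variance_count -EFinM lee_fin natrX natrX.
  have -> : 2 / 2 ^+ m.+1 = (2 ^+ m)^-1 :> R.
    by rewrite exprS; field; rewrite expf_neq0.
  have -> : (2 ^+ m) ^- 2 * (2 ^+ m * (p * (1 - p))) = (2 ^+ m)^-1 * (p * (1 - p)) :> R.
    by field; rewrite expf_neq0.
  rewrite ler_piMr // ?invr_ge0 ?exprn_ge0 //.
  by rewrite mulr_ile1 // ?subr_ge0 // gerBl.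
have Isum : (\int[P]_w (\sum_(0 <= m <oo) (f m w)%:E) < +oo)%E.
  rewrite integral_nneseries //; last by move=> m w _; rewrite lee_fin sqr_ge0.
  apply: (@le_lt_trans _ _ (\sum_(0 <= m <oo) (0 + (2 / (2 ^ m.+1)%:R)%:E))%E).
    apply: lee_nneseries => [m _ _|m _].
      by apply: integral_ge0 => w _; rewrite lee_fin sqr_ge0.
    by rewrite add0e; exact: If.
  apply: le_lt_trans (epsilon_trick _ _ _) _ => //.
  by rewrite eseries0 // ?add0e ?ltry.
have : {ae P, forall w, setT w -> (\sum_(0 <= m <oo) (f m w)%:E)%E \is a fin_num}.
  apply: integrable_ae => //; apply/integrableP; split.
    apply: (ge0_emeasurable_sum (P := xpredT)) => [m w _ _|m _].
      by rewrite lee_fin sqr_ge0.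
    exact: mf.
  under eq_integral => w _.
    rewrite gee0_abs; last by apply: nneseries_ge0 => m _ _; rewrite lee_fin sqr_ge0.
    over.
  exact: Isum.
apply: filterS => w /(_ I) fw.
have f0 : (f m w)%:E @[m --> \oo] --> 0%E.
  apply: (@squeeze_cvge _ _ _ _ (cst 0%E) _ (fun N => \sum_(N <= m <oo) (f m w)%:E)%E).
  - apply: nearW => N; rewrite lee_fin sqr_ge0 /=.
    have := @nneseries_lim_ge _ (fun m => (f m w)%:E) xpredT N N.+1.
    by rewrite big_nat1; apply=> m _ _; rewrite lee_fin sqr_ge0.
  - exact: cvg_cst.
  - apply: nneseries_tail_cvg => [|k _]; first by rewrite ltey_eq fw.
    by rewrite lee_fin sqr_ge0.
have /cvgrPdist_lt {}f0 : f m w @[m --> \oo] --> (0 : R) by exact: (fine_cvg f0).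
apply/cvgrPdist_lt => e e0.
have := f0 (e ^+ 2); rewrite exprn_gt0 // => /(_ isT); apply: filterS => m.
rewrite sub0r normrN /f normrX ltr_pXn2r // ?nnegrE ?ltW // distrC; exact.
Qed.

End strong_law.

(** * Marks read off insertion positions *)

Section insertion_marks.
Context {R : realType}.

Definition position (e : forall n, 'I_n.+1) n i : nat :=
  insertion_perm e n (inord i).

(** The upper limit is defined for every sequence of places and is measurable in it;
it is meant where the limit exists. The powers of two are those of
[frequency_cvg], and [2 ^ m] items make up the word of index [(2 ^ m).-1]. *)
Definition insertion_mark (e : forall n, 'I_n.+1) i : R :=
  fine (limn_esup (fun m => ((position e (2 ^ m).-1 i)%:R / (2 ^ m)%:R)%:E)).

Lemma limn_esup_near (u v : (\bar R)^nat) :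
  (\forall m \near \oo, u m = v m) -> limn_esup u = limn_esup v.
Proof.
move=> [N _ uv]; rewrite !limn_esup_lim; apply/cvg_lim => //.
have : esups v n @[n --> \oo] --> limn (esups v) by exact: is_cvg_esups.
apply: cvg_trans; apply: near_eq_cvg; exists N => // n /= Nn.
congr ereal_sup; apply/seteqP; split => _ [k /= nk <-]; exists k => //=.
  by rewrite uv //= (leq_trans Nn).
by rewrite -uv //= (leq_trans Nn).
Qed.

Lemma insertion_mark_cvg e i (l : R) :
  (position e (2 ^ m).-1 i)%:R / (2 ^ m)%:R @[m --> \oo] --> l ->
  insertion_mark e i = l.
Proof.
move=> h; rewrite /insertion_mark.
have /cvg_limn_einf_sup[_ ->//] : ((position e (2 ^ m).-1 i)%:R / (2 ^ m)%:R)%:E @[m --> \oo] --> l%:E.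
by apply: cvg_EFin => //; exact: nearW.
Qed.

(** A mark depends on the long run only. *)
Lemma insertion_mark_near e e' i i' n :
  (forall k, (n <= k)%N -> position e k i = position e' k i') ->
  insertion_mark e i = insertion_mark e' i'.
Proof.
move=> h; congr fine; apply: limn_esup_near; exists n => // m /= nm.
rewrite h //; apply: leq_trans nm _; rewrite -ltnS prednK ?expn_gt0 //.
exact: ltn_expl.
Qed.

Section measurability.
Context {d : measure_display} {Om : measurableType d}.
Variable e : Om -> forall n, 'I_n.+1.
Hypothesis me : forall n, measurable_fun setT (fun w => e w n).

Lemma measurable_insertion_perm n (Q : set 'S_n.+1) :
  measurable [set w | Q (insertion_perm (e w) n)].
Proof.
elim: n Q => [|n IH] Q /=.
  have [Q1|Q1] := pselect (Q 1%g).
    by rewrite (_ : mkset _ = setT) //; apply/seteqP; split.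
  by rewrite (_ : mkset _ = set0) //; apply/seteqP; split.
rewrite (_ : mkset _ = \bigcup_(j in [set: 'I_n.+2])
   ((fun w => e w n.+1) @^-1` [set j] `&`
    [set w | Q (lift_perm ord_max j (insertion_perm (e w) n))])).
  apply: fin_bigcup_measurable => [|j _]; first exact: finite_finset.
  apply: measurableI; first exact: (measurable_preimage (@me n.+1)).
  exact: (IH (fun s => Q (lift_perm ord_max j s))).
apply/seteqP; split => w /=; first by move=> Qw; exists (e w n.+1).
by move=> [j _ [/= ->]].
Qed.

Lemma measurable_insertion_mark i : measurable_fun setT (fun w => insertion_mark (e w) i).
Proof.
apply: (measurableT_comp (f := fine)) => //.
apply: measurable_fun_limn_esup => m; apply/measurable_EFinP.
apply: measurable_funM => //.
apply: (measurable_fun_dep (g := fun w => insertion_perm (e w) (2 ^ m).-1)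
  (F := fun s _ => (s (inord i) : nat)%:R : R)) => [s|s]; last by [].
exact: (measurable_insertion_perm (fun s' => s' = s)).
Qed.

End measurability.
End insertion_marks.

Lemma full_of_ae (R : realType) d (Om : measurableType d) (P : probability Om R)
  (D : set Om) : measurable D -> {ae P, forall w, D w} -> P D = 1%E.
Proof.
move=> mD /(negligibleP P (measurableC mD)) D0.
by rewrite -(setCK D) probability_setC ?D0 ?sube0 //; exact: measurableC.
Qed.

Lemma ae_of_full (R : realType) d (Om : measurableType d) (P : probability Om R)
  (D : set Om) : measurable D -> P D = 1%E -> {ae P, forall w, D w}.
Proof.
move=> mD D1; apply/(negligibleP P (measurableC mD)).
by apply: etrans (probability_setC P mD) _; rewrite D1 subee.
Qed.

Section iid_uniform_marks.
Context {R : realType} {d d' : measure_display} {A : measurableType d}.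
Context {Om : measurableType d'} {P : probability Om R}.
Variables (Z : nat -> {RV P >-> (A * R)%type}) (rho : probability (A * R)%type R).
Hypotheses (iZ : iid Z rho) (urho : unif_second_marginal rho).

Let Q (B : set R) := rho ([set: A] `*` B).

Let mark_event k (B : set R) : set Om := [set w | B (marks (path Z w) k)].

Let m_mark_event k (B : set R) : measurable B -> measurable (mark_event k B).
Proof.
move=> mB; apply: (measurable_preimage (f := fun w => marks (path Z w) k)) => //.
by apply: (measurableT_comp measurable_snd); exact: measurable_funP.
Qed.

Let Pmark k B : measurable B -> P (mark_event k B) = Q B.
Proof.
move=> mB; have [_ /(_ k)] := iZ.
move=> h; apply: etrans _ (h ([set: A] `*` B) (measurableX measurableT mB)).
by congr (P _); apply/seteqP; split => w //= [].
Qed.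

Let Pmark2 k l B C : k != l -> measurable B -> measurable C ->
  P (mark_event k B `&` mark_event l C) = (Q B * Q C)%E.
Proof.
move=> kl mB mC.
have h := iid_pair iZ kl (measurableX (@measurableT _ A) mB) (measurableX (@measurableT _ A) mC).
rewrite /Q; apply: etrans _ h.
congr (P _); apply/seteqP; split => w /=; first by move=> [Bw Cw]; split; split.
by move=> [[_ Bw] [_ Cw]]; split.
Qed.

Let mQ (B : set R) : measurable B -> measurable ([set: A] `*` B).
Proof. by move=> mB; exact: measurableX. Qed.

(** The law of a mark has distribution function q on [0, 1]. The two implications are
what the comparison with levels q outside [0, 1] needs: a level slightly below 0 or
above 1 still gives a bound on the correct side. *)
Lemma mark_cdf (q : R) : exists F : R,
  [/\ Q `]-oo, q]%classic = F%:E, (q <= 1 -> q <= F) & (0 <= q -> F <= q)].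
Proof.
have mI (i : interval R) : measurable ([set: A] `*` [set` i]).
  by apply: mQ; exact: measurable_itv.
have FE : (fine (Q `]-oo, q]%classic))%:E = Q `]-oo, q]%classic.
  by rewrite fineK // fin_num_measure.
exists (fine (Q `]-oo, q]%classic)); split => // hq.
  rewrite -lee_fin FE; have [q0|q0] := leP 0 q.
    rewrite -urho ?q0 //; apply: le_measure; rewrite ?inE //.
    by move=> [a u] /= [_]; rewrite !in_itv /= => /andP[].
  by apply: le_trans (measure_ge0 _ _); rewrite lee_fin ltW.
rewrite -lee_fin FE; have [q1|q1] := leP q 1; last first.
  by apply: le_trans (probability_le1 _ _) _ => //; rewrite lee_fin ltW.
rewrite /Q -(@measure_setI_full _ _ _ rho _ _ (mI `]-oo, q]) (mI `[0, 1])); last first.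
  by apply: urho; rewrite ler01 lexx.
rewrite -[leRHS]urho ?hq //; apply: le_measure; rewrite ?inE //; first exact: measurableI.
move=> [a u] /= [[_ uq] [_ u01]]; split => //; move: uq u01.
by rewrite !in_itv /= => -> /andP[-> _].
Qed.

Lemma mark_cell (a b : R) : 0 <= a -> a <= b -> b <= 1 -> Q `]a, b]%classic = (b - a)%:E.
Proof.
move=> a0 ab b1.
have mI (i : interval R) : measurable ([set: A] `*` [set` i]).
  by apply: mQ; exact: measurable_itv.
pose Iab : set R := `]a, b]%classic.
have Qb : Q `[0, b]%classic = b%:E by apply: urho; rewrite b1 (le_trans a0 ab).
have Qa : Q `[0, a]%classic = a%:E by apply: urho; rewrite a0 (le_trans ab b1).
have : b%:E = (Q Iab + a%:E)%E.
  rewrite -Qa -Qb.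
  apply: etrans (measureDI rho (mI `[0, b]) (mI `[0, a])) _.
  rewrite /Q /Iab; congr (rho _ + rho _)%E; apply/seteqP; split => -[y u] /=; rewrite !in_itv /=.
  - move=> [[_ /andP[u0 ub]] h]; split => //; rewrite ub andbT ltNge; apply/negP => ua.
    by apply: h; rewrite u0 ua.
  - move=> [_ /andP[au ub]]; rewrite (le_trans a0 (ltW au)) ub; split => //.
    by move=> [_]; rewrite leNgt au.
  - by move=> [_ []].
  - by move=> [_ /andP[u0 ua]]; rewrite u0 ua (le_trans ua ab).
have : Q Iab \is a fin_num by rewrite fin_num_measure //; exact: mI.
rewrite -/Iab; case: (Q Iab) => // x _; rewrite -EFinD => -[->]; congr _%:E.
by rewrite addrK.
Qed.

(** Two independent uniform marks that agree lie in the same cell of a grid of N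
equal cells, which has probability N / N^2. *)
Lemma iid_mark_neq i j : i != j -> {ae P, forall w, marks (path Z w) i != marks (path Z w) j}.
Proof.
move=> ij.
have mI (I : interval R) : measurable ([set` I] : set R) by exact: measurable_itv.
pose T : set Om := [set w | marks (path Z w) i = marks (path Z w) j].
have mm k : measurable_fun setT (fun w => marks (path Z w) k).
  by apply: (measurableT_comp measurable_snd); exact: measurable_funP.
have mT : measurable T by exact: measurable_set_eq.
suff PT0 : P T = 0%E.
  exists T; split => // w /= h; apply: contrapT => h'; apply: h.
  by apply/eqP.
pose I (N k : nat) := `](k%:R / N%:R : R), (k.+1%:R / N%:R)]%classic.
have bound N : (0 < N)%N -> (P T <= (N%:R^-1)%:E)%E.
  move=> N0; have N0' : 0 < N%:R :> R by rewrite ltr0n.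
  have full : P (mark_event i `]0, 1]%classic) = 1%E.
    by rewrite Pmark // mark_cell // ?ler01 ?subr0.
  rewrite -(@measure_setI_full _ _ _ P _ _ mT (m_mark_event i (mI _)) full).
  pose C k := mark_event i (I N k) `&` mark_event j (I N k).
  have mC k : measurable (C k) by apply: measurableI; apply: m_mark_event; exact: mI.
  apply: (@le_trans _ _ (P (\big[setU/set0]_(k < N) C k))).
    apply: le_measure; rewrite ?inE.
    - by apply: measurableI => //; apply: m_mark_event; exact: mI.
    - by apply: bigsetU_measurable => k _.
    - move=> w [/= wT]; rewrite /mark_event /= in_itv /= => /andP[u0 u1].
      rewrite -bigcup_mkord; set u := marks (path Z w) i in wT u0 u1.
      have [k [kN uI]] : exists k, (k < N)%N /\ I N k u.
        (* The cell of u is found from the least grid point that is at least u; the grid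
           point 0 is excluded because u is positive. *)
        have exm : exists m, u <= m%:R / N%:R by exists N; rewrite mulfV ?gt_eqF.
        have [[|k] um minm] := ex_minnP exm; first by move: um; rewrite mul0r leNgt u0.
        exists k; split; last first.
          rewrite /I /= in_itv /= um andbT ltNge; apply/negP => /minm.
          by rewrite ltnn.
        rewrite ltnNge; apply/negP => Nk; have /minm : u <= N%:R / N%:R by rewrite mulfV ?gt_eqF.
        by rewrite leqNgt ltnS Nk.
      by exists k => //=; rewrite /C /mark_event /= -wT.
  apply: le_trans (Boole_inequality P _) _ => //.
  rewrite (eq_bigr (fun=> (N%:R^-1 * N%:R^-1)%:E)); last first.
    move=> k _; apply: etrans (Pmark2 ij (mI _) (mI _)) _.
    have -> : Q (I N k) = (N%:R^-1)%:E.
      rewrite /I mark_cell ?divr_ge0 // ?ler_pM2r ?invr_gt0 // ?ler_nat //.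
        by congr _%:E; rewrite -mulrBl -natrB // subSnn mul1r.
      by rewrite ler_pdivrMr // mul1r ler_nat.
    by rewrite EFinM.
  rewrite sumEFin sumr_const card_ord lee_fin -[(_ * _) *+ N]mulr_natl mulrA mulfV ?mul1r //.
  by rewrite gt_eqF.
have : P T \is a fin_num by rewrite fin_num_measure.
have : (0 <= P T)%E by exact: measure_ge0.
case: (P T) bound => // x bound x0 _; congr _%:E.
apply/eqP; rewrite eq_le -[0 <= x]lee_fin x0 andbT leNgt; apply/negP => xpos.
have := bound (Num.bound x^-1); rewrite lee_fin.
have h := archi_boundP (ltW (_ : 0 < x^-1)); rewrite invr_gt0 in h.
have {}h := h xpos; rewrite -(ltr0n R) (lt_trans _ h) ?invr_gt0 // => /(_ isT).
by rewrite leNgt invf_plt ?posrE // ?h // (lt_trans _ h) // invr_gt0.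
Qed.

Lemma iid_no_ties : P (path Z @^-1` no_ties) = 1%E.
Proof.
apply: full_of_ae.
  apply: measurable_preimage (@measurable_no_ties R d A).
  by apply: measurable_path => n; exact: measurable_funP.
have : {ae P, forall w, forall i j, i != j -> marks (path Z w) i != marks (path Z w) j}.
  apply: ae_foralln => i; apply: ae_foralln => j.
  have [->|ij] := eqVneq i j; first exact: aeW.
  by have := iid_mark_neq ij; apply: filterS => w h _.
apply: filterS => w h i j ij; apply/eqP; apply: contraT => /h.
by rewrite ij eqxx.
Qed.

(** If u i exceeds q then item i comes after all the items with values at most q, and
if u i is below q it is one of them, and they come first. *)
Lemma position_frequency (u : nat -> R) n i (q : R) : (i <= n)%N ->
  (q < u i -> (\sum_(k < n.+1) (u k <= q)%R%:R : R) <=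
      (position (fun n => last_rank (first_terms u n)) n i)%:R) *
  (u i < q -> (position (fun n => last_rank (first_terms u n)) n i)%:R <=
      (\sum_(k < n.+1) (u k <= q)%R%:R : R)).
Proof.
move=> ni; rewrite /position insertion_perm_rank.
have -> : \sum_(k < n.+1) (u k <= q)%R%:R = #|[pred k : 'I_n.+1 | u k <= q]|%:R :> R.
  by rewrite -sum1_card natr_sum [RHS]big_mkcond /=; apply: eq_bigr => k _; rewrite inE; case: ifP.
have iE : (inord i : 'I_n.+1) = i :> nat by rewrite inordK.
split=> uq; rewrite ler_nat.
  apply: leq_trans (rank_ge u (inord i)); apply: subset_leq_card.
  by apply/fintype.subsetP => k; rewrite !inE iE => /le_lt_trans; apply.
apply: leq_trans (ltnW (rank_lt u (inord i))) _; apply: subset_leq_card.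
by apply/fintype.subsetP => k; rewrite !inE iE => /le_trans; apply; rewrite ltW.
Qed.

(** By the strong law the frequency of marks below a rational level in [0, 1] converges
to that level; the levels slightly below and above a mark enclose the relative place
of its item. *)
Lemma iid_insertion_mark : {ae P, forall w, forall i,
  insertion_mark (fun n => last_rank (first_terms (marks (path Z w)) n)) i =
  marks (path Z w) i}.
Proof.
have mI (I : interval R) : measurable ([set` I] : set R) by exact: measurable_itv.
have mark01 : {ae P, forall w, forall i, 0 <= marks (path Z w) i <= 1}.
  apply: ae_foralln => i.
  have : P (mark_event i `[0, 1]%classic) = 1%E.
    by rewrite Pmark //; apply: urho; rewrite ler01 lexx.
  move=> /ae_of_full h; have {}h := h (m_mark_event i (mI _)).
  by move: h; apply: filterS => w; rewrite /mark_event /= in_itv.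
(* An enumeration of the rational levels, so that countably many applications of
   the strong law suffice. *)
pose qn n : R := ratr (odflt 0 (choice.unpickle n : option rat)).
pose E n k := mark_event k `]-oo, qn n]%classic.
have freq : {ae P, forall w, forall n, exists F,
   [/\ frequency (E n) (2 ^ m) w @[m --> \oo] --> F, (qn n <= 1 -> qn n <= F) & (0 <= qn n -> F <= qn n)]}.
  apply: ae_foralln => n; have [F [QF F1 F0]] := mark_cdf (qn n).
  have : {ae P, forall w, frequency (E n) (2 ^ m) w @[m --> \oo] --> F}.
    apply: frequency_cvg.
    - by move=> k; exact: m_mark_event (mI _).
    - by move=> k; rewrite Pmark // QF.
    - by move=> k l kl; rewrite Pmark2 // !QF.
  by apply: filterS => w h; exists F.
move: freq; apply: filterS2 mark01 => w u01 freq i.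
set u := marks (path Z w) in u01 freq *.
apply: insertion_mark_cvg.
have freqE n m : frequency (E n) (2 ^ m) w = (\sum_(k < (2 ^ m).-1.+1) (u k <= qn n)%R%:R) / (2 ^ m)%:R.
  rewrite /frequency prednK ?expn_gt0 //; congr (_ / _); apply: eq_bigr => k _.
  by rewrite indicE mem_setE /mark_event /= ; congr (_%:R); apply/idP/idP; rewrite inE /= in_itv.
have dense (a b : R) : a < b -> exists n, a < qn n < b.
  move=> /rat_in_itvoo[r]; rewrite in_itv /= => rab.
  by exists (choice.pickle r); rewrite /qn choice.pickleK.
have im : \forall m \near \oo, (i <= (2 ^ m).-1)%N.
  exists i => // m /= im; rewrite -ltnS prednK ?expn_gt0 //.
  exact: leq_ltn_trans im (ltn_expl _ _).
have /andP[ui0 ui1] := u01 i.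
apply/cvgrPdist_lt => e e0.
have [n /andP[n1 n2]] := dense (u i - e) (u i) ltac:(by rewrite ltrBlDr ltrDl).
have [n' /andP[n1' n2']] := dense (u i) (u i + e) ltac:(by rewrite ltrDl).
have [F [Fc F1 _]] := freq n; have [F' [Fc' _ F0']] := freq n'.
have hF : u i - e < F by apply: lt_le_trans n1 (F1 _); rewrite ltW // (lt_le_trans n2).
have hF' : F' < u i + e by apply: le_lt_trans (F0' _) n2'; rewrite ltW // (le_lt_trans ui0).
near=> m.
have im' : (i <= (2 ^ m).-1)%N by near: m.
have lo : u i - e < frequency (E n) (2 ^ m) w by near: m; exact: (cvgr_gt _ Fc).
have up : frequency (E n') (2 ^ m) w < u i + e by near: m; exact: (cvgr_lt _ Fc').
rewrite !freqE in lo up.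
have p0 : 0 < ((2 ^ m)%:R : R)^-1 by rewrite invr_gt0 ltr0n expn_gt0.
have [/(_ n2) h _] := @position_frequency u (2 ^ m).-1 i (qn n) im'.
have [_ /(_ n1') h'] := @position_frequency u (2 ^ m).-1 i (qn n') im'.
rewrite -(ler_pM2r p0) in h; rewrite -(ler_pM2r p0) in h'.
rewrite ltr_norml; apply/andP; split.
  by rewrite ltrBrDr; have := le_lt_trans h' up; lra.
by have := lt_le_trans lo h; lra.
Unshelve. all: by end_near. Qed.

End iid_uniform_marks.

(** * Exchangeability of the recovered sequence *)

Lemma measure_ae_eq (R : realType) d (Om : measurableType d) (P : probability Om R)
  (B C : set Om) : measurable B -> measurable C -> {ae P, forall w, B w <-> C w} ->
  P B = P C.
Proof.
move=> mB mC [N [mN N0 hN]].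
have mNC := measurableC mN.
have N1 : P (~` N) = 1%E.
  apply: etrans (probability_setC P mN) _.
  by rewrite (_ : P N = 0%E) ?sube0.
rewrite -(measure_setI_full mB mNC N1) -(measure_setI_full mC mNC N1).
congr (P _); apply/seteqP; split => w [Bw Nw]; split => //;
  by have [BC CB] : B w <-> C w; [apply: contrapT => h; apply: Nw; exact: hN|auto].
Qed.

Section insertion_codes.

Lemma insertion_perm_eq (e e' : forall n, 'I_n.+1) n :
  (forall k, (k <= n)%N -> e k = e' k) -> insertion_perm e n = insertion_perm e' n.
Proof.
elim: n => [//|n IH] h /=; rewrite h // IH // => k kn.
by apply: h; exact: leqW.
Qed.

Lemma insertion_perm_inj (e e' : forall n, 'I_n.+1) n :
  insertion_perm e n = insertion_perm e' n -> forall k, (k <= n)%N -> e k = e' k.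
Proof.
elim: n => [_ [|//] _|n IH /= /lift_perm_last_inj[en h] k].
  by rewrite [LHS]ord1 [RHS]ord1.
by rewrite leq_eqVlt => /predU1P[->//|]; exact: IH.
Qed.

Lemma insertion_perm_surj n (s : 'S_n.+1) :
  exists e : forall n, 'I_n.+1, insertion_perm e n = s.
Proof.
elim: n s => [|n IH] s.
  exists (fun n => ord0); apply/permP => i; by rewrite [LHS]ord1 [RHS]ord1.
have [t ->] := lift_perm_last_surj s; have [e et] := IH t.
pose e' : forall k, 'I_k.+1 := dfwith e n.+1 (s ord_max).
exists e'; rewrite /= /e' dfwithin; congr (lift_perm _ _ _).
rewrite -et; apply: insertion_perm_eq => k kn; rewrite dfwithout //.
by rewrite neq_ltn ltnS kn orbT.
Qed.

Lemma inord_lift n i : (i <= n)%N -> inord i = lift ord_max (inord i : 'I_n.+1) :> 'I_n.+2.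
Proof.
move=> ni; apply/val_inj; rewrite /= !inordK ?ltnS ?leqW //.
by rewrite /bump leqNgt ltnS ni.
Qed.

Lemma position_lift (e : forall n, 'I_n.+1) n i : (i <= n)%N ->
  insertion_perm e n.+1 (inord i) = lift (e n.+1) (insertion_perm e n (inord i)).
Proof. by move=> ni; rewrite inord_lift // lift_perm_lift. Qed.

Lemma position_last (e : forall n, 'I_n.+1) n : insertion_perm e n (inord n) = e n.
Proof.
rewrite (_ : inord n = ord_max) ?insertion_perm_last //.
by apply/val_inj; rewrite /= inordK.
Qed.

Lemma swapn_le n a b i : (a <= n)%N -> (b <= n)%N -> (swapn a b i <= n)%N = (i <= n)%N.
Proof.
move=> an bn; rewrite /swapn; case: eqP => [->|_]; first by rewrite an bn.
by case: eqP => [->|//]; rewrite an bn.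
Qed.

Lemma inord_swapn n a b i : (a <= n)%N -> (b <= n)%N -> (i <= n)%N ->
  inord (swapn a b i) = tperm (inord a) (inord b) (inord i) :> 'I_n.+1.
Proof.
move=> an bn i_n; apply/val_inj; rewrite /= inordK ?ltnS ?swapn_le // /swapn.
case: tpermP => [/(congr1 val)|/(congr1 val)|/eqP ia /eqP ib] /=; rewrite ?inordK //.
- by move=> ->; rewrite eqxx.
- by move=> ->; rewrite eqxx; case: eqP => [->|].
- have -> : (i == a) = false by apply: contraNF ia => /eqP ->.
  by have -> : (i == b) = false by [apply: contraNF ib => /eqP ->].
Qed.

Lemma swapn_large n a b i : (a <= n)%N -> (b <= n)%N -> (n < i)%N -> swapn a b i = i.
Proof. by move=> an bn ni; rewrite /swapn !gtn_eqF // (leq_ltn_trans _ ni). Qed.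

(** Exchanging items a and b in the first n + 1 places is never undone or noticed by
the later insertions, which depend on places only. *)
Lemma position_swapn (e e' : forall n, 'I_n.+1) n a b :
  (a <= n)%N -> (b <= n)%N -> (forall k, (n < k)%N -> e k = e' k) ->
  insertion_perm e' n = (tperm (inord a) (inord b) * insertion_perm e n)%g ->
  forall k i, (n <= k)%N -> (i <= k)%N -> position e' k i = position e k (swapn a b i).
Proof.
move=> an bn ee' h; elim=> [|k IH] i.
  rewrite leqn0 => /eqP n0 i0; rewrite n0 in an bn h *.
  by rewrite /position h permM inord_swapn.
rewrite leq_eqVlt => /predU1P[<- i_n|nk].
  by rewrite /position h permM inord_swapn.
rewrite leq_eqVlt => /predU1P[->|ik].
  by rewrite /position (swapn_large an bn) // !position_last ee'.
have bk m : (m <= n)%N -> (m <= k)%N by move/leq_trans; apply.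
rewrite /position !position_lift ?(swapn_le i (bk _ an) (bk _ bn)) // ee' //.
congr (nat_of_ord (lift _ _)); apply/val_inj; exact: IH.
Qed.

End insertion_codes.

Section recovery.
Context {R : realType} {d : measure_display} {A : measurableType d}.

(** Item i is the letter that sits at place eta_i when it is inserted. *)
Definition recover (w : gewp_space A) (i : nat) : A * R :=
  (tnth (w i).1 (w i).2, insertion_mark (fun n => (w n).2) i).

Lemma measurable_word n : measurable_fun setT (fun w : gewp_space A => (w n).1).
Proof.
exact: (measurableT_comp measurable_fst
  (@measurable_coordinate _ (fun n => n.+1.-tuple A * 'I_n.+1)%type n)).
Qed.

Lemma measurable_eta n : measurable_fun setT (fun w : gewp_space A => (w n).2).
Proof.
exact: (measurableT_comp measurable_snd
  (@measurable_coordinate _ (fun n => n.+1.-tuple A * 'I_n.+1)%type n)).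
Qed.

Lemma measurable_letter d' (Om : measurableType d') n (W : Om -> n.-tuple A)
    (e : Om -> 'I_n) :
  measurable_fun setT W -> (forall i, measurable (e @^-1` [set i])) ->
  measurable_fun setT (fun w => tnth (W w) (e w)).
Proof.
move=> mW me.
apply: (measurable_fun_dep (g := e) (F := fun i w => tnth (W w) i)) => // i.
by move/measurable_fun_tnthP : mW; apply.
Qed.

Lemma measurable_recover i : measurable_fun setT (fun w : gewp_space A => recover w i).
Proof.
apply: measurable_fun_pair.
  apply: measurable_letter; first exact: measurable_word.
  by move=> j; exact: (measurable_preimage (@measurable_eta i)).
exact: (measurable_insertion_mark measurable_eta).
Qed.

End recovery.

Section gewp_sequences.
Context {R : realType} {d d' : measure_display} {A : measurableType d}.
Context {Om : measurableType d'} {P : probability Om R}.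
Variables (W : forall n : nat, {RV P >-> n.+1.-tuple A})
          (eta : forall n : nat, {RV P >-> 'I_n.+1}).
Hypothesis gW : is_gewp W eta.

Let e (w : Om) : forall n, 'I_n.+1 := fun n => eta n w.

Lemma tail_sigma_antitone n : tail_sigma W eta n.+1 `<=` tail_sigma W eta n.
Proof.
apply: sub_smallest2r; first exact: smallest_sigma_algebra.
move=> C [k /= nk kC]; exists k => //=; exact: ltnW.
Qed.

Lemma tail_sigma_eta n (i : 'I_n.+2) : tail_sigma W eta n (eta n.+1 @^-1` [set i]).
Proof.
apply: sub_sigma_algebra; exists n => //=; right; exists [set i] => //.
by rewrite setTI.
Qed.

Lemma tail_sigma_measurable n : tail_sigma W eta n `<=` measurable.
Proof.
apply: smallest_sub; first exact: sigma_algebra_measurable.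
move=> _ [k _ [[B mB <-]|[B mB <-]]]; apply: measurableI => //;
  exact: (measurable_preimage (measurable_funP _)).
Qed.

(** The insertion place eta_(n + 1) is uniform and independent of F_(n + 1), and the
insertion permutation at time n is, by induction, uniform and independent of F_n,
which contains both eta_(n + 1) and F_(n + 1). *)
Lemma insertion_perm_uniform n (s : 'S_n.+1) C : tail_sigma W eta n C ->
  P ([set w | insertion_perm (e w) n = s] `&` C) = (((n.+1)`!%:R^-1)%:E * P C)%E.
Proof.
elim: n s C => [|n IH] s C tC.
  have -> : (1`!)%:R^-1 = 1 :> R by rewrite invr1.
  rewrite mul1e (_ : mkset _ = setT) ?setTI //.
  by apply/seteqP; split => // w _ /=; apply/permP => i; rewrite [LHS]ord1 [RHS]ord1.
have [t st] := lift_perm_last_surj s; set j := s ord_max in st.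
have -> : [set w | insertion_perm (e w) n.+1 = s] `&` C =
    [set w | insertion_perm (e w) n = t] `&` (eta n.+1 @^-1` [set j] `&` C).
  apply/seteqP; split => w /=; rewrite st.
    by move=> [/lift_perm_last_inj[ej et] Cw].
  by move=> [-> [ej Cw]]; rewrite /e ej.
rewrite IH; last first.
  apply: (@measurableI _ (g_sigma_algebraType _)); first exact: tail_sigma_eta.
  exact: tail_sigma_antitone.
have [unif ind _] := gW n.+1.
rewrite (ind _ _ _ tC) // unif muleA -EFinM; congr (_%:E * _)%E.
by rewrite [in RHS]factS natrM invfM mulrC.
Qed.

Lemma sum_insertion_perm n (B : set Om) : measurable B ->
  P B = (\sum_(s : 'S_n.+1) P ([set w | insertion_perm (e w) n = s] `&` B))%E.
Proof.
move=> mB; apply: measure_finite_partition.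
- move=> s; apply: measurableI => //.
  exact: (@measurable_insertion_perm _ _ e (fun k => measurable_funP (eta k)) n [set s]).
- by move=> s s' _ _ [w [[/= <- _] [<- _]]].
- by apply/seteqP; split => w; [move=> Bw; exists (insertion_perm (e w) n)|move=> [s _ []]].
Qed.

(** Erasing undoes insertion, so that each item keeps its letter while its place moves.
This is where condition (iii) of a GEWP enters. *)
Lemma erased_letters : {ae P, forall w, forall n i, (i <= n)%N ->
  tnth (W n w) (insertion_perm (e w) n (inord i)) = tnth (W i w) (e w i)}.
Proof.
have : {ae P, forall w, forall n, W n w = erase (W n.+1 w) (eta n.+1 w)}.
  by apply: ae_foralln => n; have [_ _] := gW n.
apply: filterS => w h; elim=> [|n IH] i.
  by rewrite leqn0 => /eqP ->; rewrite position_last.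
rewrite leq_eqVlt => /predU1P[->|i_n]; first by rewrite position_last.
by rewrite position_lift // -IH // [in RHS]h tnth_mktuple.
Qed.

Definition recovered (i : nat) (w : Om) : A * R := recover (gewp_path W eta w) i.

Lemma measurable_recovered i : measurable_fun setT (recovered i).
Proof.
exact: (measurableT_comp (@measurable_recover _ _ _ i) (measurable_gewp_path W eta)).
Qed.

Let X : Om -> seq_space (fun _ : nat => A * R : measurableType _)%type := path recovered.

Let mX : measurable_fun setT X.
Proof. exact: measurable_path measurable_recovered. Qed.

Section fixed_insertion_perm.
Variables (n : nat) (code : 'S_n.+1 -> forall k, 'I_k.+1).
Hypothesis codeK : forall s, insertion_perm (code s) n = s.

Let merge (s : 'S_n.+1) (w : Om) : forall k, 'I_k.+1 :=
  fun k => if (k <= n)%N then code s k else e w k.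

(** The recovered sequence when the insertion permutation at time n is s. For fixed s
it depends only on W_n and on later words and places, hence on F_n
([reconstruct_tail]). *)
Definition reconstruct (s : 'S_n.+1) (w : Om) :
    seq_space (fun _ : nat => A * R : measurableType _)%type :=
  fun i => (if (i <= n)%N then tnth (W n w) (s (inord i)) else tnth (W i w) (e w i),
            insertion_mark (merge s w) i).

Lemma merge_perm s w : insertion_perm (merge s w) n = s.
Proof. by rewrite -[RHS]codeK; apply: insertion_perm_eq => k kn; rewrite /merge kn. Qed.

Lemma merge_eq w : merge (insertion_perm (e w) n) w = e w.
Proof.
apply: functional_extensionality_dep => k; rewrite /merge; case: leqP => // kn.
by apply: insertion_perm_inj kn; rewrite codeK.
Qed.

(** Letters of the first items are read in W_n instead of in the earlier words, and the
places up to n are replaced by constants. *)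
Lemma reconstruct_tail s C : measurable C ->
  tail_sigma W eta n (reconstruct s @^-1` C).
Proof.
move=> mC.
pose TOm := g_sigma_algebraType (\bigcup_(k in [set k | (n <= k)%N])
        (preimage_set_system setT (W k) measurable `|`
         preimage_set_system setT (eta k.+1) measurable)).
have mWt k : (n <= k)%N -> measurable_fun setT (W k : TOm -> _).
  move=> nk _ B mB; apply: sub_sigma_algebra; exists k => //=; left; exists B => //.
have met k : (n < k)%N -> measurable_fun setT (eta k : TOm -> _).
  case: k => // k nk _ B mB; apply: sub_sigma_algebra; exists k => //=; right; exists B => //.
have mm k : measurable_fun setT (fun w : TOm => merge s w k).
  rewrite /merge; case: leqP => kn; first exact: measurable_cst.
  exact: met.
suff : measurable_fun setT (reconstruct s : TOm -> _).
  by move=> /measurable_preimage h; exact: h.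
apply: measurable_seq => i; apply: measurable_fun_pair; last first.
  exact: (measurable_insertion_mark mm).
case: leqP => i_n.
  apply: measurable_letter => [|j]; first exact: mWt.
  have [->|jE] := eqVneq j (s (inord i)).
    by rewrite (_ : _ @^-1` _ = setT) //; apply/seteqP; split.
  by rewrite (_ : _ @^-1` _ = set0) //; apply/seteqP; split => // w /= /eqP; rewrite eq_sym (negbTE jE).
apply: measurable_letter => [|j]; first by apply: mWt; exact: ltnW.
exact: (measurable_preimage (met _ i_n)).
Qed.

Lemma reconstruct_swapn a b s w i : (a <= n)%N -> (b <= n)%N ->
  reconstruct s w (swapn a b i) = reconstruct (tperm (inord a) (inord b) * s)%g w i.
Proof.
move=> an bn; rewrite /reconstruct swapn_le //; congr pair.
  case: leqP => i_n; first by rewrite inord_swapn // permM.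
  by rewrite (swapn_large an bn).
apply/esym/(@insertion_mark_near _ _ _ _ _ (maxn n i)) => k; rewrite geq_max => /andP[nk ik].
apply: (position_swapn an bn) => //; last by rewrite !merge_perm.
by move=> m nm; rewrite /merge leqNgt nm.
Qed.

Lemma recovered_reconstruct : {ae P, forall w, X w = reconstruct (insertion_perm (e w) n) w}.
Proof.
apply: filterS erased_letters => w h; apply/funext => i.
rewrite /X /path /recovered /recover /reconstruct merge_eq; congr pair.
by case: leqP => // i_n; rewrite (h n i i_n).
Qed.

(** Splitting according to the value s of the insertion permutation, which is uniform
and independent of the reconstructed sequence. *)
Lemma swapped_law a b C : (a <= n)%N -> (b <= n)%N -> measurable C ->
  P (path (fun i => recovered (swapn a b i)) @^-1` C) =
  (\sum_(s : 'S_n.+1) ((n.+1)`!%:R^-1)%:E *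
     P (reconstruct (tperm (inord a) (inord b) * s)%g @^-1` C))%E.
Proof.
move=> an bn mC.
have mXs : measurable (path (fun i => recovered (swapn a b i)) @^-1` C).
  apply: measurable_preimage mC; apply: measurable_path => i.
  exact: measurable_recovered.
rewrite (sum_insertion_perm n mXs); apply: eq_bigr => s _.
set t := tperm _ _.
have tG := reconstruct_tail (t * s)%g mC.
have ms : measurable [set w | insertion_perm (e w) n = s].
  exact: (@measurable_insertion_perm _ _ e (fun k => measurable_funP (eta k)) n [set s]).
rewrite -(insertion_perm_uniform s tG); apply: measure_ae_eq.
- exact: measurableI.
- by apply: measurableI => //; exact: tail_sigma_measurable tG.
apply: filterS recovered_reconstruct => w Xw.
have sw : insertion_perm (e w) n = s ->
    path (fun i => recovered (swapn a b i)) w = reconstruct (t * s)%g w.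
  by move=> <-; apply/funext => i; rewrite -reconstruct_swapn // -Xw.
by split => -[h]; rewrite /preimage /= sw.
Qed.

End fixed_insertion_perm.

(** In [swapped_law] the transposition only permutes the terms of the sum over s. *)
Lemma recovered_exchangeable : exchangeable P recovered.
Proof.
move=> a b C mC; pose n := maxn a b.
have /choice[code codeK] := @insertion_perm_surj n.
rewrite (swapped_law codeK (leq_maxl a b) (leq_maxr a b) mC).
have -> : path recovered = path (fun i => recovered (swapn 0 0 i)).
  by congr path; apply/funext => i; congr recovered; rewrite /swapn; case: eqP => // ->.
rewrite (swapped_law codeK (leq0n n) (leq0n n) mC).
rewrite [LHS](reindex_inj (mulgI (tperm (inord a) (inord b)))).
rewrite [RHS](reindex_inj (mulgI (tperm (inord 0) (inord 0)))).
by apply: eq_bigr => s _; rewrite !mulgA !tperm2 !mul1g.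
Qed.

End gewp_sequences.

(** * Sorting the recovered sequence *)

Section insertion_law.
Context {R : realType} {d d' : measure_display} {A : measurableType d}.
Context {Om : measurableType d'} {P : probability Om R}.
Variables (W : forall n : nat, {RV P >-> n.+1.-tuple A})
          (eta : forall n : nat, {RV P >-> 'I_n.+1}).
Hypothesis gW : is_gewp W eta.

Local Notation insertions := (seq_space (fun n => 'I_n.+1 : measurableType _)).

Definition insertion_path (w : Om) : insertions := fun n => eta n w.

Lemma measurable_insertion_path : measurable_fun setT insertion_path.
Proof. by apply: measurable_seq => n; exact: measurable_funP. Qed.

Lemma insertion_path_cylinder n (code : 'S_n.+1 -> forall k, 'I_k.+1)
    (B : forall k, set 'I_k.+1) :
  (forall s, insertion_perm (code s) n = s) ->
  P (insertion_path @^-1` cylinder n.+1 B) =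
  (\sum_(s : 'S_n.+1) if `[< cylinder n.+1 B (code s) >] then ((n.+1)`!%:R^-1)%:E else 0)%E.
Proof.
move=> codeK.
have mB : measurable (insertion_path @^-1` cylinder n.+1 B).
  by apply: (measurable_preimage measurable_insertion_path); exact: measurable_cylinder.
rewrite (sum_insertion_perm eta n mB); apply: eq_bigr => s _.
have sB w : insertion_perm (fun k => eta k w) n = s ->
    cylinder n.+1 B (insertion_path w) <-> cylinder n.+1 B (code s).
  move=> ws; have eqk := insertion_perm_inj (etrans (codeK s) (esym ws)).
  by split=> h k kn; have := h k kn; rewrite /insertion_path eqk.
case: asboolP => sc.
  have := insertion_perm_uniform gW s (C := setT).
  rewrite probability_setT mule1 setIT => <-.
    congr (P _); apply/seteqP; split => w /=; first by case.
    by move=> ws; split=> //; apply/(sB _ ws).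
  have [s0 sC _] := smallest_sigma_algebra setT (\bigcup_(k in [set k | (n <= k)%N])
    (preimage_set_system setT (W k) measurable `|`
     preimage_set_system setT (eta k.+1) measurable)).
  by have := sC _ s0; rewrite setD0.
rewrite (_ : _ `&` _ = set0) ?measure0 //.
by apply/seteqP; split => // w [/= /sB h1 /h1].
Qed.

End insertion_law.

(** Through insertion permutations, cylinders of insertion places are events on a
uniform permutation. *)
Lemma insertion_law_eq (R : realType) d d1 d2 (A : measurableType d)
    (Om1 : measurableType d1) (Om2 : measurableType d2)
    (P1 : probability Om1 R) (P2 : probability Om2 R)
    (W1 : forall n : nat, {RV P1 >-> n.+1.-tuple A})
    (eta1 : forall n : nat, {RV P1 >-> 'I_n.+1})
    (W2 : forall n : nat, {RV P2 >-> n.+1.-tuple A})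
    (eta2 : forall n : nat, {RV P2 >-> 'I_n.+1}) :
  is_gewp W1 eta1 -> is_gewp W2 eta2 ->
  forall C, measurable C ->
  P1 (insertion_path eta1 @^-1` C) = P2 (insertion_path eta2 @^-1` C).
Proof.
move=> g1 g2; apply: seq_law_eq.
- exact: measurable_insertion_path.
- exact: measurable_insertion_path.
- case=> [|n] B _.
    rewrite (_ : cylinder 0 B = setT) ?preimage_setT ?probability_setT //.
    by apply/seteqP; split.
  have /choice[code codeK] := @insertion_perm_surj n.
  by rewrite (insertion_path_cylinder g1 B codeK) (insertion_path_cylinder g2 B codeK).
Qed.

Section reference_law.
Context {R : realType} {d : measure_display} (A : measurableType d).

(** Constant letters with uniform marks: an i.i.d. sequence of this law serves to establish the
almost sure properties of insertion places, which are then shared by all GEWPs. *)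
Definition reference_law : probability (A * R)%type R := (dirac (point : A) \x unit_law)%E.

Lemma reference_law_unif : unif_second_marginal reference_law.
Proof.
move=> t t01; rewrite -(unit_law_ray t01).
pose I : set R := `[0, t]%classic; have mI : measurable I by exact: measurable_itv.
apply: etrans (product_measure1E (dirac (point : A)) (unit_law : probability R R) measurableT mI) _.
transitivity (1 * unit_law I)%E; first by congr (_ * _)%E; exact: diracT.
rewrite mul1e /= /unit_law /I; congr lebesgue_measure.
apply/seteqP; split => u /=; rewrite !in_itv /=.
  by move=> [/andP[_ ->]].
by move=> [-> /andP[-> ->]].
Qed.

End reference_law.

Section recovered_process.
Context {R : realType} {d d' : measure_display} {A : measurableType d}.
Hypothesis hA : borel_space R A.
Context {Om : measurableType d'} {P : probability Om R}.
Variables (W : forall n : nat, {RV P >-> n.+1.-tuple A})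
          (eta : forall n : nat, {RV P >-> 'I_n.+1}).
Hypothesis gW : is_gewp W eta.

Local Notation insertions := (seq_space (fun n => 'I_n.+1 : measurableType _)).
Local Notation S := (seq_space (fun _ : nat => A * R : measurableType _)%type).

Let m_ins n : measurable_fun setT (fun x : insertions => x n).
Proof. exact: (@measurable_coordinate _ (fun n => 'I_n.+1 : measurableType _) n). Qed.

Let mark_path (x : insertions) : S := fun n => (point, insertion_mark x n).

Let m_mark_path : measurable_fun setT mark_path.
Proof.
apply: measurable_seq => n; apply: measurable_fun_pair; first exact: measurable_cst.
exact: (measurable_insertion_mark (e := fun x : insertions => x) m_ins).
Qed.

(** The properties that make sorting inverse to recovery, gathered in one event on the
insertion places so that its probability is the same for all GEWPs. *)
Let good : set insertions := [set x |
  no_ties (mark_path x) /\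
  forall n, last_rank (first_terms (insertion_mark x : nat -> R) n) = x n].

Let m_good : measurable good.
Proof.
have -> : good = mark_path @^-1` no_ties `&`
  \bigcap_n \bigcup_(j in [set: 'I_n.+1])
  ([set x : insertions | last_rank (first_terms (insertion_mark x : nat -> R) n) = j] `&`
   [set x : insertions | x n = j]).
  apply/seteqP; split => x /= [nt h]; split => // n; first by move=> _; exists (x n) => /=.
  by have [j _ [/= -> ->]] := h n I.
apply: measurableI; first exact: (measurable_preimage m_mark_path (@measurable_no_ties _ _ _)).
apply: bigcap_measurableType => n _; apply: fin_bigcup_measurable => [|j _].
  exact: finite_finset.
apply: measurableI; last exact: (measurable_preimage (@m_ins n) (B := [set j])).
apply: (measurable_preimage (f := fun x : insertions =>
   last_rank (first_terms (insertion_mark x : nat -> R) n)) (B := [set j])) => //.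
apply: measurable_last_rank; apply: measurable_first_terms => k.
exact: (measurable_insertion_mark (e := fun x : insertions => x) m_ins).
Qed.

Let transfer C : measurable C ->
  exists Z : nat -> {RV (bit_law : probability (seq_space (fun _ : nat => bool)) R) >-> (A * R)%type},
  iid Z (reference_law A) /\
  P (insertion_path eta @^-1` C) = bit_law (insertion_path (ios_Eta Z) @^-1` C).
Proof.
move=> mC; have [Z iZ] := exists_iid hA (@reference_law_unif R _ A).
exists Z; split => //.
apply: (insertion_law_eq gW _ mC).
apply: exchangeable_is_gewp; first exact: iid_exchangeable iZ.
exact: iid_no_ties iZ (@reference_law_unif R _ A).
Qed.

Let good_full : P (insertion_path eta @^-1` good) = 1%E.
Proof.
have [Z [iZ ->]] := transfer m_good.
apply: full_of_ae.
  exact: measurable_preimage (measurable_insertion_path _) m_good.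
have nt := iid_no_ties iZ (@reference_law_unif R _ A).
have mnt : measurable (path Z @^-1` no_ties).
  apply: measurable_preimage (@measurable_no_ties R d A).
  by apply: measurable_path => n; exact: measurable_funP.
have {nt mnt} := ae_of_full mnt nt.
apply: filterS2 (iid_insertion_mark iZ (@reference_law_unif R _ A)) => w h nt.
have hE : insertion_mark (insertion_path (ios_Eta Z) w) = marks (path Z w) :> (nat -> R).
  by apply/funext => i; exact: h.
split; rewrite /mark_path hE //.
Qed.

Let X := recovered W eta.

Lemma recovered_no_ties : P (path X @^-1` no_ties) = 1%E.
Proof.
apply: full_of_ae.
  apply: measurable_preimage (@measurable_no_ties R d A).
  by apply: measurable_path => n; exact: measurable_recovered.
have /ae_of_full h := good_full.
have {}h := h (measurable_preimage (measurable_insertion_path _) m_good).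
by apply: filterS h => w [].
Qed.

(** On the good event the recovered marks insert each item at the given place, so the
sorted word puts each item where W_n has it. *)
Lemma recovered_path : {ae P, forall w, sorted_path (path X w) = gewp_path W eta w}.
Proof.
have /ae_of_full h := good_full.
have {}h := h (measurable_preimage (measurable_insertion_path _) m_good).
apply: filterS2 h (erased_letters gW) => w [nt rk] wd.
apply: functional_extensionality_dep => n; rewrite /sorted_path /gewp_path; congr pair.
  apply/esym/ios_unique => i.
  rewrite -insertion_perm_rank.
  have -> : insertion_perm (fun n => last_rank (first_terms (marks (path X w)) n)) n =
     insertion_perm (fun n => eta n w) n.
    by apply: insertion_perm_eq => k _; exact: rk.
  by rewrite -[i in LHS]inord_val wd // -ltnS.
exact: rk.
Qed.

Lemma recovered_mark_law (t : R) : 0 <= t <= 1 ->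
  P [set w | 0 <= (X 0 w).2 <= t] = t%:E.
Proof.
move=> t01; pose C : set insertions := [set x | 0 <= (insertion_mark x 0 : R) <= t].
have mC : measurable C.
  rewrite (_ : C = (fun x : insertions => insertion_mark x 0 : R) @^-1` `[0, t]).
    apply: measurable_preimage; last exact: measurable_itv.
    exact: (measurable_insertion_mark (e := fun x : insertions => x) m_ins).
  by apply/seteqP; split => x; rewrite /C /preimage /= in_itv.
have [Z [iZ h]] := transfer mC.
apply: etrans h _.
have mt : measurable ([set: A] `*` `[0, t]%classic) by apply: measurableX => //; exact: measurable_itv.
rewrite -(reference_law_unif A t01); have [_ /(_ 0 _ mt) <-] := iZ.
apply: measure_ae_eq.
- exact: measurable_preimage (measurable_insertion_path _) mC.
- exact: (measurable_preimage (measurable_funP (Z 0))).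
apply: filterS (iid_insertion_mark iZ (@reference_law_unif R _ A)) => w h.
have hE : insertion_mark (insertion_path (ios_Eta Z) w) 0 = (Z 0 w).2 :> R by exact: h.
by rewrite /preimage /C /= hE in_itv /=; split => [|[]].
Qed.

End recovered_process.

(** * Exchangeable laws dominated by an i.i.d. law *)

Section domination.
Context {R : realType} {d d0 d1 : measure_display} {T : measurableType d}.
Context {Om0 : measurableType d0} {Om1 : measurableType d1}.
Context {P0 : probability Om0 R} {P1 : probability Om1 R}.
Variables (Z : nat -> {RV P0 >-> T}) (rho : probability T R) (X : nat -> Om1 -> T).
Variable (t : R).
Hypotheses (iZ : iid Z rho) (mX : forall n, measurable_fun setT (X n)).
Hypotheses (exX : exchangeable P1 X) (t0 : 0 < t).
Hypothesis dom : forall C, measurable C ->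
  (t%:E * P1 (path X @^-1` C) <= P0 (path Z @^-1` C))%E.

Local Notation S := (seq_space (fun _ : nat => T)).

Let deviation k (D : set T) (p : R) m (x : S) : R :=
  `|frequency (fun j => [set y : S | D (y (k + j)%N)]) (2 ^ m) x - p|.

Let m_coord (D : set T) k : measurable D -> measurable [set y : S | D (y k)].
Proof. exact: (measurable_preimage (@measurable_coordinate _ (fun=> T) k)). Qed.

Let m_frequency k (D : set T) m : measurable D ->
  measurable_fun setT (fun x : S => frequency (fun j => [set y : S | D (y (k + j)%N)]) (2 ^ m) x : R).
Proof.
move=> mD; apply: measurable_funM => //; apply: measurable_sum => j.
by apply: measurable_indic; exact: m_coord.
Qed.

(** Convergence of the frequencies of the i.i.d. sequence is an almost sure property
of its law, and null sets of that law are null for the dominated one. *)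
Lemma dominated_frequency_cvg k (D : set T) : measurable D ->
  {ae P1, forall w, frequency (fun j => X (k + j)%N @^-1` D) (2 ^ m) w @[m --> \oo] --> fine (rho D)}.
Proof.
move=> mD; set p := fine (rho D).
have pE : rho D = p%:E by rewrite /p fineK // fin_num_measure.
(* The event that the frequencies converge, written with an upper limit so that it
   is a measurable set of sequences. *)
pose C : set S := [set x | limn_esup (fun m => (deviation k D p m x)%:E) = 0%E].
have mC : measurable C.
  apply: (measurable_preimage (f := fun x : S => limn_esup (fun m => (deviation k D p m x)%:E))
    (B := [set 0%E])) => //.
  apply: measurable_fun_limn_esup => m; apply/measurable_EFinP.
  apply: (measurableT_comp (f := fun r : R => `|r|)) => //.
  by apply: measurable_funB => //; exact: m_frequency.
have P0C : P0 (path Z @^-1` C) = 1%E.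
  apply: full_of_ae.
    apply: measurable_preimage mC; apply: measurable_path => n; exact: measurable_funP.
  have : {ae P0, forall w, frequency (fun j => Z (k + j)%N @^-1` D) (2 ^ m) w @[m --> \oo] --> p}.
    apply: frequency_cvg.
    - by move=> j; exact: (measurable_preimage (measurable_funP _)).
    - by move=> j; rewrite -pE; have [_ /(_ (k + j)%N _ mD)] := iZ.
    - move=> i j ij; rewrite EFinM -pE; apply: (iid_pair iZ) => //.
      by rewrite eqn_add2l.
  apply: filterS => w h; rewrite /C /preimage /=.
  have : (deviation k D p m (path Z w))%:E @[m --> \oo] --> 0%E.
    apply: cvg_EFin; first exact: nearW.
    rewrite -(normr0 R); apply: cvg_norm; rewrite -(subrr p).
    by apply: cvgB; [exact: h|exact: cvg_cst].
  by move/cvg_limn_einf_sup => [].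
have P1C : P1 (path X @^-1` ~` C) = 0%E.
  have := dom (measurableC mC).
  have mZC : measurable (path Z @^-1` C).
    apply: measurable_preimage mC; apply: measurable_path => n; exact: measurable_funP.
  have -> : P0 (path Z @^-1` ~` C) = 0%E.
    by apply: etrans (probability_setC P0 mZC) _; rewrite P0C subee.
  by rewrite pmule_rle0 ?lte_fin // measure_le0 => /eqP.
exists (path X @^-1` ~` C); split => //.
  by apply: (measurable_preimage (measurable_path mX)); exact: measurableC.
move=> w /= h Cw; apply: h.
have : (deviation k D p m (path X w))%:E @[m --> \oo] --> 0%E.
  by apply: limn_esup_le_cvg => [|m]; [rewrite Cw|rewrite lee_fin normr_ge0].
move=> /fine_cvg /= h; apply/cvgrPdist_lt => e e0.
move/cvgrPdist_lt : h => /(_ e e0); apply: filterS => m.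
by rewrite sub0r normrN normr_id distrC.
Qed.

(** By exchangeability, given the first k terms, the term X_k is distributed as each
later one; the probability that it lies in D can be averaged over 2^m of them, and
the averages converge to the constant rho D. *)
Lemma dominated_split k (B : nat -> set T) (D : set T) :
  (forall i, measurable (B i)) -> measurable D ->
  P1 (X k @^-1` D `&` path X @^-1` cylinder (T := fun _ : nat => T) k B) =
  (rho D * P1 (path X @^-1` cylinder (T := fun _ : nat => T) k B))%E.
Proof.
move=> mB mD; set p := fine (rho D).
have pE : rho D = p%:E by rewrite /p fineK // fin_num_measure.
set C := path X @^-1` _.
have mC : measurable C.
  by apply: (measurable_preimage (measurable_path mX)); exact: measurable_cylinder.
have mE j : measurable (X j @^-1` D) by exact: measurable_preimage (mX j) mD.
have exE j : P1 (X (k + j)%N @^-1` D `&` C) = P1 (X k @^-1` D `&` C).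
  pose G : set S := [set x | D (x k)] `&` cylinder (T := fun _ : nat => T) k B.
  have mG : measurable G by apply: measurableI; [exact: m_coord|exact: measurable_cylinder].
  rewrite -[RHS]/(P1 (path X @^-1` G)) -(exX k (k + j) mG); congr (P1 _).
  rewrite /C /G; apply/seteqP; split => w /= [Dw Cw]; split.
  - by rewrite /path /swapn eqxx.
  - move=> i ik; have := Cw i ik; rewrite /path /swapn (ltn_eqF ik).
    by rewrite (ltn_eqF (leq_trans ik (leq_addr _ _))).
  - by move: Dw; rewrite /path /swapn eqxx.
  - move=> i ik; have := Cw i ik; rewrite /path /swapn (ltn_eqF ik).
    by rewrite (ltn_eqF (leq_trans ik (leq_addr _ _))).
pose f m w : \bar R := (frequency (fun j => X (k + j)%N @^-1` D) (2 ^ m) w)%:E.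
have mf m : measurable_fun C (f m).
  apply: measurable_funTS; apply/measurable_EFinP; apply: measurable_funM => //.
  by apply: measurable_sum => j; exact: measurable_indic.
have If m : (\int[P1]_(w in C) f m w = P1 (X k @^-1` D `&` C))%E.
  have N0 : 0 < (2 ^ m)%:R :> R by rewrite ltr0n expn_gt0.
  have fE w : f m w = (((2 ^ m)%:R^-1)%:E * \sum_(j < 2 ^ m) (\1_(X (k + j)%N @^-1` D) w)%:E)%E.
    by rewrite sumEFin -EFinM mulrC.
  under eq_integral do rewrite fE.
  have m1 (j : nat) : measurable_fun C (fun w => (\1_(X (k + j)%N @^-1` D) w)%:E : \bar R).
    by apply: measurable_funTS; apply/measurable_EFinP; exact: measurable_indic.
  rewrite ge0_integralZl_EFin //; first last.
  - by apply: emeasurable_sum => j; exact: m1.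
  - by move=> w _; rewrite sume_ge0.
  rewrite ge0_integral_sum //.
  rewrite (eq_bigr (fun=> P1 (X k @^-1` D `&` C))); last first.
    by move=> j _; rewrite integral_indic //; exact: exE.
  have : P1 (X k @^-1` D `&` C) \is a fin_num by rewrite fin_num_measure //; exact: measurableI.
  case: (P1 (X k @^-1` D `&` C)) => // x _.
  rewrite sumEFin sumr_const card_ord -EFinM; congr _%:E.
  by rewrite -[x *+ _]mulr_natl mulKf // gt_eqF.
have fc : {ae P1, forall w, C w -> f ^~ w @ \oo --> (cst p%:E w : \bar R)}.
  have := @dominated_frequency_cvg k D mD; apply: filterS => w h _.
  by apply: cvg_EFin; [exact: nearW|exact: h].
have f1 : {ae P1, forall w n, C w -> (`|f n w| <= cst 1%E w)%E}.
  apply: aeW => w n _; rewrite /f /= lee_fin /frequency ger0_norm; last first.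
    by rewrite divr_ge0 // sumr_ge0.
  rewrite ler_pdivrMr ?ltr0n ?expn_gt0 // mul1r.
  apply: le_trans (_ : \sum_(j < 2 ^ n) 1 <= _); last by rewrite sumr_const card_ord.
  by apply: ler_sum => j _; rewrite indicE; case: (_ \in _).
have i1 : P1.-integrable C (cst 1%E).
  exact: finite_measure_integrable_cst.
have [_ _] := dominated_convergence mC mf (measurable_cst _) fc i1 f1.
rewrite integral_cst // => h.
have hc : (fun m => \int[P1]_(w in C) f m w)%E @ \oo --> P1 (X k @^-1` D `&` C).
  by under eq_fun do rewrite If; exact: cvg_cst.
by rewrite -pE in h; exact: (cvg_unique _ hc h).
Qed.

Lemma exchangeable_dominated_iid : iid_law P1 X rho.
Proof.
elim=> [|k IH] B mB.
  rewrite big_ord0 (_ : _ @^-1` _ = setT) ?probability_setT //.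
  by apply/seteqP; split.
rewrite big_ord_recr /= -IH // muleC -(dominated_split k mB (mB k)).
congr (P1 _); apply/seteqP; split => w /=.
  by move=> h; split; [exact: (h k)|move=> i ik; exact: h (ltnW ik)].
by move=> [Bk h] i; rewrite ltnS leq_eqVlt => /predU1P[->//|]; exact: h.
Qed.

End domination.

(** * Extreme laws *)

Section sorted_paths.
Context {R : realType} {d : measure_display} {A : measurableType d}.
Local Notation S := (seq_space (fun _ : nat => A * R : measurableType _)%type).

(** The sequences of which sorting loses nothing ([recover_sorted_path]). *)
Definition recovered_marks : set S := [set x | forall i,
  insertion_mark (fun n => last_rank (first_terms (marks x) n)) i = marks x i].

Lemma measurable_recovered_marks : measurable recovered_marks.
Proof.
rewrite (_ : recovered_marks = \bigcap_i [set x : S |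
  insertion_mark (fun n => last_rank (first_terms (marks x) n)) i = marks x i]).
  apply: bigcap_measurableType => i _; apply: measurable_set_eq.
    apply: (measurable_insertion_mark
      (e := fun x : S => fun n => last_rank (first_terms (marks x) n))) => n.
    exact: measurable_sorted_last_rank.
  exact: measurable_marks.
by apply/seteqP; split => x /= h i => [_|]; exact: h.
Qed.

Lemma recover_sorted_path (x : S) : recovered_marks x -> recover (sorted_path x) = x.
Proof.
move=> h; apply/funext => i; rewrite /recover /= h.
by rewrite -rank_last ios_rank /letters /marks; case: (x i).
Qed.

Lemma measurable_recover_path : measurable_fun setT (recover : gewp_space A -> S).
Proof. by apply: measurable_seq => i; exact: measurable_recover. Qed.

End sorted_paths.

Section iid_gewp.
Context {R : realType} {d d' : measure_display} {A : measurableType d}.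
Hypothesis hA : borel_space R A.
Context {Om : measurableType d'} {P : probability Om R}.
Variables (Z : nat -> {RV P >-> (A * R)%type}) (rho : probability (A * R)%type R).
Hypotheses (iZ : iid Z rho) (urho : unif_second_marginal rho).
Local Notation S := (seq_space (fun _ : nat => A * R : measurableType _)%type).

Let mZ : measurable_fun setT (path Z).
Proof. by apply: measurable_path => n; exact: measurable_funP. Qed.

Lemma iid_is_gewp : is_gewp (ios_W Z) (ios_Eta Z).
Proof.
apply: exchangeable_is_gewp; first exact: iid_exchangeable iZ.
exact: iid_no_ties iZ urho.
Qed.

Lemma gewp_law_recover (C : set S) : measurable C ->
  gewp_law (ios_W Z) (ios_Eta Z) (recover @^-1` C) = P (path Z @^-1` C).
Proof.
move=> mC; have mrC := measurable_preimage (@measurable_recover_path R d A) mC.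
rewrite -[LHS]/(P (gewp_path (ios_W Z) (ios_Eta Z) @^-1` (recover @^-1` C))).
apply: measure_ae_eq.
- exact: (measurable_preimage (measurable_gewp_path (ios_W Z) (ios_Eta Z)) mrC).
- exact: measurable_preimage mZ mC.
apply: filterS (iid_insertion_mark iZ urho) => w h.
have -> : (gewp_path (ios_W Z) (ios_Eta Z) @^-1` (recover @^-1` C)) w =
  C (recover (sorted_path (path Z w))) by [].
by rewrite recover_sorted_path.
Qed.

(** The domination passes to the recovered sequences; the one of mu is exchangeable,
hence i.i.d. of law rho, and mu is the law of its sorted path. *)
Lemma dominated_gewp_law (mu : probability (gewp_space A) R) (t : R) :
  0 < t -> gewp_laws R A mu ->
  (forall B, measurable B -> (t%:E * mu B <= gewp_law (ios_W Z) (ios_Eta Z) B)%E) ->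
  mu ≡μ gewp_law (ios_W Z) (ios_Eta Z).
Proof.
move=> t0 [d1 [Om1 [P1 [W1 [eta1 [g1 law1]]]]]] dom.
pose X := recovered W1 eta1.
have iX : iid_law P1 X rho.
  apply: (exchangeable_dominated_iid iZ (measurable_recovered W1 eta1)
    (recovered_exchangeable g1) t0) => C mC.
  have mrC := measurable_preimage (@measurable_recover_path R d A) mC.
  have := dom _ mrC; rewrite gewp_law_recover //.
  by rewrite -(law1 _ mrC).
move=> B mB; rewrite -(law1 _ mB).
have msB := measurable_preimage (@measurable_sorted_path R d A) mB.
have mX : measurable_fun setT (path X) by exact: measurable_path (measurable_recovered W1 eta1).
transitivity (P1 (path X @^-1` (sorted_path @^-1` B))).
  rewrite -[LHS]/(P1 (gewp_path W1 eta1 @^-1` B)).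
  apply: measure_ae_eq.
  - exact: (measurable_preimage (measurable_gewp_path W1 eta1) mB).
  - exact: measurable_preimage mX msB.
  by apply: filterS (recovered_path hA g1) => w h; rewrite /preimage /= h.
rewrite -[RHS]/(P (path Z @^-1` (sorted_path @^-1` B))).
have mZn n : measurable_fun setT (Z n) by exact: measurable_funP.
exact: (iid_law_eq (measurable_recovered W1 eta1) mZn iX (iffLR (iid_lawP _ _) iZ) msB).
Qed.

Lemma iid_gewp_law_extreme : erg_gewp_laws R A (gewp_law (ios_W Z) (ios_Eta Z)).
Proof.
split.
  exists d', Om, P, (ios_W Z), (ios_Eta Z); split; first exact: iid_is_gewp.
  by [].
move=> t mu1 mu2 /andP[t0 t1] K1 K2 mix.
have s0 : 0 < 1 - t by rewrite subr_gt0.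
split.
  apply: (dominated_gewp_law t0 K1) => B mB; rewrite (mix B mB) leeDl //.
  by rewrite mule_ge0 // lee_fin ltW.
apply: (dominated_gewp_law s0 K2) => B mB; rewrite (mix B mB) leeDr //.
by rewrite mule_ge0 // lee_fin ltW.
Qed.

End iid_gewp.

Section GEWP_laws.
Context {R : realType} {d : measure_display} {A : measurableType d}.
Hypothesis hA : borel_space R A.

Lemma GEWP_witness (rho : probability (A * R)%type R) : unif_second_marginal rho ->
  exists (d' : measure_display) (Om : measurableType d')
    (P : probability Om R) (Z : nat -> {RV P >-> (A * R)%type}),
  iid Z rho /\ gewp_law (ios_W Z) (ios_Eta Z) = GEWP rho.
Proof.
move=> urho; apply: (@xgetPex _ point [set mu | exists (d' : measure_display) (Om : measurableType d')
      (P : probability Om R) (Z : nat -> {RV P >-> (A * R)%type}),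
    iid Z rho /\ gewp_law (ios_W Z) (ios_Eta Z) = mu]).
have [Z iZ] := exists_iid hA urho.
by exists (gewp_law (ios_W Z) (ios_Eta Z)), _, _, bit_law, Z.
Qed.

Lemma iid_gewp_law_eq d1 d2 (Om1 : measurableType d1) (Om2 : measurableType d2)
    (P1 : probability Om1 R) (P2 : probability Om2 R)
    (Z1 : nat -> {RV P1 >-> (A * R)%type}) (Z2 : nat -> {RV P2 >-> (A * R)%type}) rho :
  iid Z1 rho -> iid Z2 rho ->
  gewp_law (ios_W Z1) (ios_Eta Z1) ≡μ gewp_law (ios_W Z2) (ios_Eta Z2).
Proof.
move=> i1 i2 B mB.
have msB := measurable_preimage (@measurable_sorted_path R d A) mB.
rewrite -[LHS]/(P1 (path Z1 @^-1` (sorted_path @^-1` B))).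
rewrite -[RHS]/(P2 (path Z2 @^-1` (sorted_path @^-1` B))).
have m1 n : measurable_fun setT (Z1 n) by exact: measurable_funP.
have m2 n : measurable_fun setT (Z2 n) by exact: measurable_funP.
exact: (iid_law_eq m1 m2 (iffLR (iid_lawP _ _) i1) (iffLR (iid_lawP _ _) i2) msB).
Qed.

Lemma iid_GEWP d1 (Om1 : measurableType d1) (P1 : probability Om1 R)
    (Z1 : nat -> {RV P1 >-> (A * R)%type}) rho :
  unif_second_marginal rho -> iid Z1 rho ->
  gewp_law (ios_W Z1) (ios_Eta Z1) ≡μ GEWP rho.
Proof.
move=> urho i1; have [d2 [Om2 [P2 [Z2 [i2 <-]]]]] := GEWP_witness urho.
exact: iid_gewp_law_eq i1 i2.
Qed.

Lemma GEWP_recover rho (B : set (A * R)) : unif_second_marginal rho -> measurable B ->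
  GEWP rho ((fun w => recover w 0) @^-1` B) = rho B.
Proof.
move=> urho mB; have [d2 [Om2 [P2 [Z2 [i2 <-]]]]] := GEWP_witness urho.
have mC := measurable_preimage (@measurable_coordinate _ (fun=> (A * R : measurableType _)%type) 0) mB.
apply: etrans (gewp_law_recover i2 urho mC) _.
by have [_ /(_ 0 _ mB)] := i2.
Qed.

End GEWP_laws.

Section conditioning.
Context {R : realType} {d : measure_display} {Om : measurableType d}.
Variables (P : probability Om R) (E : set Om) (mE : measurable E).

Definition conditional : probability Om R := mnormalize (mrestr P mE) P.

(** The product form avoids division of extended reals. *)
Lemma conditionalE (U : set Om) : P E != 0%E ->
  (P E * conditional U)%E = P (U `&` E).
Proof.
move=> PE0; have TE : mrestr P mE setT = P E by rewrite /mrestr setTI.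
have PEfin : P E \is a fin_num by rewrite fin_num_measure.
rewrite /conditional /= /mnormalize; case: ifPn => [/orP[]/eqP h|_].
- by move/eqP : PE0; rewrite -TE; case; exact: h.
- by move: PEfin; rewrite -TE (_ : mrestr _ _ _ = +oo%E) //; exact: h.
transitivity (P E * (P (U `&` E) * (fine (P E))^-1%:E))%E.
  by congr (_ * (_ * (fine _)^-1%:E))%E; exact: TE.
rewrite muleCA -[X in (_ * (X * _))%E](fineK PEfin) -EFinM divff ?mule1 //.
by rewrite -eqe fineK.
Qed.

End conditioning.

(** The sequence X is to be the one recovered from a GEWP with an extreme law;
[recovered_marks] says that it is also recovered from its own sorted path. *)
Section extreme_is_iid.
Context {R : realType} {d d' : measure_display} {A : measurableType d}.
Context {Om : measurableType d'} {P : probability Om R}.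
Variable X : nat -> {RV P >-> (A * R)%type}.
Hypothesis exX : exchangeable P X.
Hypothesis distinct : P (path X @^-1` no_ties) = 1%E.
Hypothesis marked : P (path X @^-1` recovered_marks) = 1%E.
Hypothesis extreme : erg_gewp_laws R A (gewp_law (ios_W X) (ios_Eta X)).
Local Notation S := (seq_space (fun _ : nat => A * R : measurableType _)%type).

Let Xs n : {RV P >-> (A * R)%type} := X n.+1.

Let mX : measurable_fun setT (path X).
Proof. by apply: measurable_path => n; exact: measurable_funP. Qed.

Let mXs : measurable_fun setT (path Xs).
Proof. by apply: measurable_path => n; exact: measurable_funP. Qed.

Let shift_law C : measurable C -> P (path Xs @^-1` C) = P (path X @^-1` C).
Proof.
move=> mC; apply: (exchangeable_inj (s := succn) _ exX) => //; last by move=> i j [].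
Qed.

Section conditioned.
Variable (B : set (A * R)).
Hypothesis mB : measurable B.
Let E : set Om := X 0 @^-1` B.
Let mE : measurable E. Proof. exact: (measurable_preimage (measurable_funP (X 0))). Qed.
Hypothesis PE0 : P E != 0%E.

Let Q := conditional P mE.
Let Y n : {RV Q >-> (A * R)%type} := X n.+1.

Let PQ U : (P E * Q U)%E = P (U `&` E).
Proof. exact: conditionalE. Qed.

Let PE_cancel (U V : set Om) : P (U `&` E) = P (V `&` E) -> Q U = Q V.
Proof.
have PEfin : P E \is a fin_num by rewrite fin_num_measure.
have PEV : ((fine (P E))^-1%:E * P E)%E = 1%E.
  by rewrite -[X in (_ * X)%E]fineK // -EFinM mulVf // -eqe fineK.
rewrite -!PQ => /(congr1 (fun z => (fine (P E))^-1%:E * z)%E).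
by rewrite !muleA PEV !mul1e.
Qed.

Lemma conditioned_law D : measurable D ->
  (P E * gewp_law (ios_W Y) (ios_Eta Y) D)%E = P (path Xs @^-1` (sorted_path @^-1` D) `&` E).
Proof. by move=> mD; rewrite -PQ. Qed.

(** A transposition of the shifted sequence is one of X that fixes X_0, so it preserves
the conditional law; there are still no ties. *)
Lemma conditioned_gewp : gewp_laws R A (gewp_law (ios_W Y) (ios_Eta Y)).
Proof.
exists d', Om, Q, (ios_W Y), (ios_Eta Y); split => //.
apply: exchangeable_is_gewp.
  move=> i j C mC; apply: PE_cancel.
  pose G : set S := [set x | C (fun n => x n.+1)] `&` [set x | B (x 0)].
  have mG : measurable G.
    apply: measurableI.
      exact: (measurable_preimage (measurable_reindex succn) mC).
    exact: (measurable_preimage (@measurable_coordinate _ (fun=> (A * R : measurableType _)%type) 0) mB).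
  rewrite -[RHS]/(P (path X @^-1` G)) -(exX i.+1 j.+1 mG).
  congr (P _); apply/seteqP; split => w [Cw Bw]; split => //;
    move: Cw; rewrite /preimage /=; congr C; apply/funext => n;
    rewrite /path /Y /swapn /= !eqSS; by case: ifP => // _; case: ifP.
have nt : P (path Xs @^-1` no_ties) = 1%E.
  by rewrite shift_law //; exact: measurable_no_ties.
rewrite -(@probability_setT _ _ _ Q); apply: PE_cancel.
rewrite setTI setIC; apply: measure_setI_full nt => //.
exact: measurable_preimage mXs (@measurable_no_ties R d A).
Qed.

End conditioned.

(** The law of the sorted shifted sequence is the mixture of its conditional laws given
that X_0 is or is not in B. By extremality conditioning on X_0 does not change the
law of the sorted path, nor that of the sequence recovered from it, which is the
shifted sequence itself. *)
Lemma first_independent (B : set (A * R)) (C : set S) : measurable B -> measurable C ->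
  P (X 0 @^-1` B `&` path Xs @^-1` C) = (P (X 0 @^-1` B) * P (path X @^-1` C))%E.
Proof.
move=> mB mC; set E := X 0 @^-1` B.
have mE : measurable E by exact: (measurable_preimage (measurable_funP (X 0))).
have mXC := measurable_preimage mXs mC.
have [E0|E0] := eqVneq (P E) 0%E.
  rewrite E0 mul0e; apply: (subset_measure0 _ _ _ E0) => //; exact: measurableI.
have [E1|E1] := eqVneq (P (X 0 @^-1` ~` B)) 0%E.
  have PE : P E = 1%E by apply: full_of_ae => //; apply/negligibleP => //; exact: measurableC.
  by rewrite PE mul1e setIC measure_setI_full // shift_law.
have mBc : measurable (~` B) by exact: measurableC.
have [mu0 ext] := extreme.
have PEfin : P E \is a fin_num by rewrite fin_num_measure.
have PEC : P (X 0 @^-1` ~` B) = (1 - P E)%E by exact: (probability_setC P mE).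
have [] := ext (fine (P E)) _ _ _ (conditioned_gewp mB E0) (conditioned_gewp mBc E1).
- rewrite -!lte_fin fineK // lt_neqAle eq_sym E0 measure_ge0 /=.
  rewrite lt_neqAle probability_le1 // andbT; apply: contra E1 => /eqP E1.
  by rewrite PEC E1 subee.
- move=> D mD; rewrite EFinB fineK // -PEC !conditioned_law //.
  have msD := measurable_preimage (@measurable_sorted_path R d A) mD.
  rewrite -[LHS]/(P (path X @^-1` (sorted_path @^-1` D))) -(shift_law msD).
  have mF := measurable_preimage mXs msD.
  apply: etrans (measureDI P mF mE) _; rewrite addeC; congr (_ + _)%E.
move=> law _.
have mrC := measurable_preimage (@measurable_recover_path R d A) mC.
have := conditioned_law mB E0 mrC; rewrite (law _ mrC).
have mrec := @measurable_recovered_marks R d A.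
have msrC := measurable_preimage (@measurable_sorted_path R d A) mrC.
have recX (V : nat -> {RV P >-> (A * R)%type}) : measurable_fun setT (path V) ->
  P (path V @^-1` recovered_marks) = 1%E ->
  {ae P, forall w, recover (sorted_path (path V w)) = path V w}.
  move=> mV /(ae_of_full (measurable_preimage mV mrec)); apply: filterS => w.
  exact: recover_sorted_path.
have -> : P (path Xs @^-1` (sorted_path @^-1` (recover @^-1` C)) `&` X 0 @^-1` B) =
    P (E `&` path Xs @^-1` C).
  apply: measure_ae_eq; [|exact: measurableI|].
    by apply: measurableI => //; exact: measurable_preimage mXs msrC.
  have h := recX Xs mXs (etrans (shift_law mrec) marked).
  by apply: filterS h => w h; rewrite /preimage /= h; split => -[].
move=> <-; congr (_ * _)%E.
rewrite -[LHS]/(P (path X @^-1` (sorted_path @^-1` (recover @^-1` C)))).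
apply: measure_ae_eq; [exact: measurable_preimage mX msrC|exact: measurable_preimage mX mC|].
by apply: filterS (recX X mX marked) => w h; rewrite /preimage /= h.
Qed.

Lemma extreme_iid : iid X (distribution P (X 0)).
Proof.
apply/iid_lawP; elim=> [|n IH] B mB.
  rewrite big_ord0 (_ : _ @^-1` _ = setT) ?probability_setT //.
  by apply/seteqP; split.
rewrite big_ord_recl -(IH (fun k => B k.+1)) //.
have mC := measurable_cylinder n (B := fun k => B k.+1) (fun k => mB k.+1).
apply: etrans _ (first_independent (mB 0) mC).
congr (P _); apply/seteqP; split => w /= h.
  by split; [exact: (h 0)|move=> k kn; exact: (h k.+1)].
by case: h => h0 h [|k] kn //; exact: h.
Qed.

End extreme_is_iid.

Theorem theorem1 (R : realType) (d : measure_display) (A : measurableType d)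
    (hA : borel_space R A) :
  (forall (rho : probability (A * R)%type R), unif_second_marginal rho ->
    forall (d' : measure_display) (Om : measurableType d')
      (P : probability Om R) (Z : nat -> {RV P >-> (A * R)%type}),
    iid Z rho ->
    is_ergodic_gewp (ios_W Z) (ios_Eta Z) /\
    gewp_law (ios_W Z) (ios_Eta Z) ≡μ GEWP rho) /\
  law_bijection (@unif_second_marginal R d A) (erg_gewp_laws R A) (@GEWP R d A).
Proof.
split=> [rho urho d' Om P Z iZ|].
  split; last exact: (iid_GEWP hA urho iZ).
  split; first exact: iid_is_gewp iZ urho.
  exact: (iid_gewp_law_extreme hA iZ urho).
split.
- move=> rho urho; have [d' [Om [P [Z [iZ <-]]]]] := GEWP_witness hA urho.
  exact: (iid_gewp_law_extreme hA iZ urho).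
- move=> rho rho' urho urho' rr.
  have [d' [Om [P [Z [iZ <-]]]]] := GEWP_witness hA urho.
  apply: (iid_GEWP hA urho'); have [mi law] := iZ; split => // j B mB.
  by rewrite (law j B mB) (rr B mB).
- move=> rho rho' urho urho' GG B mB.
  apply: etrans (esym (GEWP_recover hA urho mB)) _.
  apply: etrans _ (GEWP_recover hA urho' mB).
  exact: (GG _ (measurable_preimage (@measurable_recover R d A 0) mB)).
- move=> mu [[d' [Om [P [W [eta [gW law]]]]]] ext].
  pose X n : {RV P >-> (A * R)%type} := mfun_Sub (mem_set (measurable_recovered W eta n)).
  have mX : measurable_fun setT (path X).
    exact: (measurable_path (measurable_recovered W eta)).
  have lawX : gewp_law (ios_W X) (ios_Eta X) ≡μ mu.
    move=> B mB; rewrite -(law _ mB).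
    have msB := measurable_preimage (@measurable_sorted_path R d A) mB.
    rewrite -[LHS]/(P (path X @^-1` (sorted_path @^-1` B))).
    rewrite -[RHS]/(P (gewp_path W eta @^-1` B)); apply: measure_ae_eq.
    - exact: measurable_preimage mX msB.
    - exact: (measurable_preimage (measurable_gewp_path W eta) mB).
    by apply: filterS (recovered_path hA gW) => w h; rewrite /preimage /= h.
  have iX : iid X (distribution P (X 0)).
    apply: extreme_iid.
    - exact: recovered_exchangeable gW.
    - exact: (recovered_no_ties hA gW).
    - apply: full_of_ae; first exact: measurable_preimage mX (@measurable_recovered_marks R d A).
      apply: filterS (recovered_path hA gW) => w h i.
      have -> : (fun n => last_rank (first_terms (marks (path X w)) n)) =
          (fun n => eta n w).
        apply: functional_extensionality_dep => n.
        exact: (congr1 (fun p : gewp_space A => (p n).2) h).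
      by [].
    - split; first by exists d', Om, P, (ios_W X), (ios_Eta X); split => //;
        apply: exchangeable_is_gewp; [exact: recovered_exchangeable gW|exact: (recovered_no_ties hA gW)].
      move=> t mu1 mu2 t01 K1 K2 mix.
      have [|h1 h2] := ext t mu1 mu2 t01 K1 K2.
        by move=> B mB; exact: etrans (esym (lawX B mB)) (mix B mB).
      by split=> B mB; [exact: etrans (h1 B mB) (esym (lawX B mB))|exact: etrans (h2 B mB) (esym (lawX B mB))].
  have uX : unif_second_marginal (distribution P (X 0) : probability (A * R)%type R).
    move=> t t01; rewrite -(recovered_mark_law hA gW t01).
    congr (P _); apply/seteqP; split => w; rewrite /preimage /= in_itv /=; first by case.
    by move=> h; split.
  exists (distribution P (X 0)) => // B mB.
  by rewrite -(iid_GEWP hA uX iX mB) (lawX B mB).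
Qed.
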